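(* Let $W=W_{D_n}$ ($n\ge4$) or $W=W_{B_n}$ ($n\ge 2$), and let $\mathfrak{H}^{\mathfrak c}_W$ be the degenerate affine Hecke-Clifford algebra of type $D_n$ (parameter $u\in\mathbb{C}$), respectively of type $B_n$ (parameters $u,v\in\mathbb{C}$). The multiplication of the subalgebras $\mathbb{C}[x_1,\dots,x_n]$, $\mathcal{C}_n$ and $\mathbb{C}W$ induces a vector space isomorphism $$\mathbb{C}[x_1,\dots,x_n]\otimes\mathcal{C}_n\otimes\mathbb{C}W\longrightarrow\mathfrak{H}^{\mathfrak c}_W.$$ Equivalently, the elements $x^\alpha c^\epsilon w$ with $\alpha\in\mathbb{Z}_+^n$, $\epsilon\in\mathbb{Z}_2^n$, $w\in W$ form a linear basis for $\mathfrak{H}^{\mathfrak c}_W$.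
   Context: $\mathbb{Z}_+$ denotes the nonnegative integers; $x^\alpha=x_1^{a_1}\cdots x_n^{a_n}$ for $\alpha=(a_1,\dots,a_n)$, and $c^\epsilon=c_1^{\epsilon_1}\cdots c_n^{\epsilon_n}$ for $\epsilon=(\epsilon_1,\dots,\epsilon_n)$, $\epsilon_i\in\{0,1\}$. $\mathcal{C}_n$ is the Clifford algebra generated by $c_1,\dots,c_n$ with $c_i^2=1$, $c_ic_j=-c_jc_i$ ($i\ne j$). The map is the one induced by the natural homomorphisms of $\mathbb{C}[x_1,\dots,x_n]$, $\mathcal{C}_n$, $\mathbb{C}W$ into $\mathfrak{H}^{\mathfrak c}_W$. Both Weyl groups are generated by $s_1,\dots,s_n$ with $s_i^2=1$, where $s_1,\dots,s_{n-1}$ satisfy the Coxeter relations of $S_n$ with $s_i=(i,i+1)$. In $W_{D_n}$ additionally $s_is_n=s_ns_i$ ($i\ne n-2$) and $s_{n-2}s_ns_{n-2}=s_ns_{n-2}s_n$. In $W_{B_n}$ additionally $s_is_n=s_ns_i$ ($i\le n-2$) and $(s_{n-1}s_n)^4=1$. $\mathfrak{H}^{\mathfrak c}_W$ is the unital associative $\mathbb{C}$-algebra generated by $x_i,c_i,s_i$ ($1\le i\le n$) subject to the relations of $W$ for the $s_i$, the relations of $\mathcal{C}_n$ for the $c_i$, and: $x_ix_j=x_jx_i$; $x_ic_i=-c_ix_i$, $x_ic_j=c_jx_i$ ($i\ne j$); $\sigma c_i=c_{\sigma(i)}\sigma$ for $\sigma\in S_n=\langle s_1,\dots,s_{n-1}\rangle$;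 for $1\le i\le n-1$, $x_{i+1}s_i-s_ix_i=u(1-c_{i+1}c_i)$ and $x_js_i=s_ix_j$ ($j\neq i,i+1$); together with: - type $D_n$: $s_nc_n=-c_{n-1}s_n$; $s_nc_i=c_is_n$ ($i\ne n-1,n$); $s_nx_n+x_{n-1}s_n=-u(1+c_{n-1}c_n)$; $s_nx_i=x_is_n$ ($i\neq n-1,n$); - type $B_n$: $s_nc_n=-c_ns_n$; $s_nc_i=c_is_n$ ($i\ne n$); $s_nx_n+x_ns_n=-\sqrt2\,v$; $s_nx_i=x_is_n$ ($i\ne n$). *)

(* Defs.v *)
From HB Require Import structures.
From mathcomp Require Import all_boot all_order all_algebra all_fingroup finmap.
From mathcomp Require Import generic_quotient monalg complex boolp reals.

Set Implicit Arguments.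
Unset Strict Implicit.
Unset Printing Implicit Defensive.

Import GRing.Theory Num.Theory.

Local Open Scope quotient_scope.
Local Open Scope ring_scope.

Section LinearExtension.
Variables (K : comNzRingType) (T : choiceType) (V : lmodType K) (b : T -> V).

(* {malg K[T]} is the vector space of finitely supported functions T -> K. *)
Definition linext (f : {malg K[T]}) : V :=
  \sum_(t <- msupp f) f@_t *: b t.

Definition lin_independent : Prop := forall f, linext f = 0 -> f = 0.
Definition spanning : Prop := forall v, exists f, linext f = v.
Definition is_basis : Prop := lin_independent /\ spanning.

Lemma linext_wide (f : {malg K[T]}) (d : {fset T}) :
  (msupp f `<=` d)%fset -> linext f = \sum_(t <- d) f@_t *: b t.
Proof.
move=> le; rewrite /linext (big_fset_incl _ le) // => t _ /mcoeff_outdom ->.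
by rewrite scale0r.
Qed.

Lemma linext_is_linear : linear linext.
Proof.
move=> k f g.
pose d := (msupp f `|` msupp g `|` msupp (k *: f + g))%fset.
rewrite !(@linext_wide _ d) ?fsubsetUr //; first last.
- by rewrite /d -fsetUA fsubsetUl.
- by rewrite /d fsetUAC fsubsetUr.
rewrite scaler_sumr -big_split /=; apply: eq_bigr => t _.
by rewrite mcoeffD mcoeffZ scalerDl scalerA.
Qed.

HB.instance Definition _ :=
  GRing.isLinear.Build K {malg K[T]} V *:%R linext linext_is_linear.

Lemma linextU t : linext << t >> = b t.
Proof.
rewrite (@linext_wide _ [fset t]%fset) ?msuppU_le //.
by rewrite big_seq_fset1 mcoeffUU scale1r.
Qed.

End LinearExtension.

(* Quotient of a vector space by the linear relations p = q, for rel p q. *)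
Section LinearQuotient.
Variables (K : pzRingType) (V : lmodType K) (rel : V -> V -> Prop).

Inductive lcong : V -> V -> Prop :=
| lcong_rel p q : rel p q -> lcong p q
| lcong_refl p : lcong p p
| lcong_sym p q : lcong p q -> lcong q p
| lcong_trans p q r : lcong p q -> lcong q r -> lcong p r
| lcong_add p q p' q' : lcong p q -> lcong p' q' -> lcong (p + p') (q + q')
| lcong_scale k p q : lcong p q -> lcong (k *: p) (k *: q).

Let lcongb p q := `[< lcong p q >].

Fact lcongb_refl : reflexive lcongb.
Proof. by move=> p; apply/asboolP/lcong_refl. Qed.
Fact lcongb_sym : symmetric lcongb.
Proof. by move=> p q; apply/asboolP/asboolP => /lcong_sym. Qed.
Fact lcongb_trans : transitive lcongb.
Proof.
by move=> q p r /asboolP pq /asboolP qr; apply/asboolP; apply: lcong_trans qr.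
Qed.

Definition lcong_equiv := EquivRel lcongb lcongb_refl lcongb_sym lcongb_trans.

Definition lquot := {eq_quot lcong_equiv}.
HB.instance Definition _ := Choice.on lquot.
HB.instance Definition _ := EqQuotient.on lquot.

Definition lpi (p : V) : lquot := \pi_lquot p.

Lemma lpi_eq p q : lpi p = lpi q <-> lcong p q.
Proof.
split; first by move/eqmodP/asboolP.
by move=> pq; apply/eqmodP/asboolP.
Qed.

Lemma lpi_repr (a : lquot) : lpi (repr a) = a. Proof. exact: reprK. Qed.

Lemma lcong_repr p : lcong (repr (lpi p)) p.
Proof. by apply/lpi_eq; rewrite lpi_repr. Qed.

Lemma lquotP (P : lquot -> Prop) : (forall p, P (lpi p)) -> forall a, P a.
Proof. by move=> Pp a; rewrite -[a]lpi_repr. Qed.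

(* The operations are locked to prevent costly unfolding during unification. *)
Fact lquot_key : unit. Proof. exact: tt. Qed.
Definition lquot_zero : lquot := lpi 0.
Definition lquot_add : lquot -> lquot -> lquot :=
  locked_with lquot_key (fun a b => lpi (repr a + repr b)).
Definition lquot_opp : lquot -> lquot :=
  locked_with lquot_key (fun a => lpi (- repr a)).
Definition lquot_scale : K -> lquot -> lquot :=
  locked_with lquot_key (fun k a => lpi (k *: repr a)).

Lemma lpi_add p q : lquot_add (lpi p) (lpi q) = lpi (p + q).
Proof.
by rewrite /lquot_add unlock; apply/lpi_eq/lcong_add; apply: lcong_repr.
Qed.
Lemma lpi_scale k p : lquot_scale k (lpi p) = lpi (k *: p).
Proof. by rewrite /lquot_scale unlock; apply/lpi_eq/lcong_scale/lcong_repr. Qed.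
Lemma lpi_opp p : lquot_opp (lpi p) = lpi (- p).
Proof.
rewrite /lquot_opp unlock; apply/lpi_eq.
by rewrite -!scaleN1r; apply/lcong_scale/lcong_repr.
Qed.

Fact lquot_addA : associative lquot_add.
Proof.
by elim/lquotP=> p; elim/lquotP=> q; elim/lquotP=> r; rewrite !lpi_add addrA.
Qed.
Fact lquot_addC : commutative lquot_add.
Proof. by elim/lquotP=> p; elim/lquotP=> q; rewrite !lpi_add addrC. Qed.
Fact lquot_add0 : left_id lquot_zero lquot_add.
Proof. by elim/lquotP=> p; rewrite lpi_add add0r. Qed.
Fact lquot_addN : left_inverse lquot_zero lquot_opp lquot_add.
Proof. by elim/lquotP=> p; rewrite lpi_opp lpi_add addNr. Qed.

HB.instance Definition _ :=
  GRing.isZmodule.Build lquot lquot_addA lquot_addC lquot_add0 lquot_addN.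

Fact lquot_scaleA k l a :
  lquot_scale k (lquot_scale l a) = lquot_scale (k * l) a.
Proof. by elim/lquotP: a => p; rewrite !lpi_scale scalerA. Qed.
Fact lquot_scale1 : left_id 1 lquot_scale.
Proof. by elim/lquotP=> p; rewrite lpi_scale scale1r. Qed.
Fact lquot_scaleDr : right_distributive lquot_scale +%R.
Proof.
move=> k; elim/lquotP=> p; elim/lquotP=> q.
by rewrite [_ + _]lpi_add !lpi_scale scalerDr [RHS]lpi_add.
Qed.
Fact lquot_scaleDl a : {morph lquot_scale^~ a : k l / k + l}.
Proof.
by elim/lquotP: a => p k l; rewrite !lpi_scale [RHS]lpi_add scalerDl.
Qed.

HB.instance Definition _ := GRing.Zmodule_isLmodule.Build K lquot
  lquot_scaleA lquot_scale1 lquot_scaleDr lquot_scaleDl.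

Fact lpi_is_linear : linear lpi.
Proof.
by move=> k p q; rewrite -lpi_add -lpi_scale.
Qed.

HB.instance Definition _ :=
  GRing.isLinear.Build K V lquot *:%R lpi lpi_is_linear.

(* Universal property of the quotient. *)
Variables (U : lmodType K) (f : {linear V -> U}).

Definition lquot_lift (a : lquot) : U := f (repr a).

Hypothesis f_rel : forall p q, rel p q -> f p = f q.

Lemma linear_lcong p q : lcong p q -> f p = f q.
Proof.
elim=> {p q} //.
- by move=> p q r _ -> _ ->.
- by move=> p q p' q' _ e _ e'; rewrite !linearD e e'.
- by move=> k p q _ e; rewrite !linearZ e.
Qed.

Lemma lquot_liftE p : lquot_lift (lpi p) = f p.
Proof. exact/linear_lcong/lcong_repr. Qed.

Lemma lquot_lift_linear : linear lquot_lift.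
Proof.
move=> k; elim/lquotP=> p; elim/lquotP=> q.
by rewrite -linearP !lquot_liftE linearP.
Qed.

End LinearQuotient.

Arguments lpi {K V} rel p.

Section Tensor.
Variables (K : comNzRingType) (U V : lmodType K).

Let pure (u : U) (v : V) : {malg K[(U * V)%type]} := << (u, v) >>.

Inductive bilinear_rel : {malg K[(U * V)%type]} -> {malg K[(U * V)%type]} -> Prop :=
| bilin_Dl u u' v : bilinear_rel (pure (u + u') v) (pure u v + pure u' v)
| bilin_Dr u v v' : bilinear_rel (pure u (v + v')) (pure u v + pure u v')
| bilin_Zl k u v : bilinear_rel (pure (k *: u) v) (k *: pure u v)
| bilin_Zr k u v : bilinear_rel (pure u (k *: v)) (k *: pure u v).

Definition tensor := lquot bilinear_rel.
HB.instance Definition _ := GRing.Lmodule.on tensor.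

Definition tens (u : U) (v : V) : tensor := lpi bilinear_rel (pure u v).

Lemma tens_Dl u u' v : tens (u + u') v = tens u v + tens u' v.
Proof.
by rewrite [LHS](iffRL (lpi_eq _ _ _) (lcong_rel (bilin_Dl _ _ _))) linearD.
Qed.
Lemma tens_Dr u v v' : tens u (v + v') = tens u v + tens u v'.
Proof.
by rewrite [LHS](iffRL (lpi_eq _ _ _) (lcong_rel (bilin_Dr _ _ _))) linearD.
Qed.
Lemma tens_Zl k u v : tens (k *: u) v = k *: tens u v.
Proof.
by rewrite [LHS](iffRL (lpi_eq _ _ _) (lcong_rel (bilin_Zl _ _ _))) linearZ.
Qed.
Lemma tens_Zr k u v : tens u (k *: v) = k *: tens u v.
Proof.
by rewrite [LHS](iffRL (lpi_eq _ _ _) (lcong_rel (bilin_Zr _ _ _))) linearZ.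
Qed.

(* Universal property of the tensor product. *)
Section Lift.
Variables (W : lmodType K) (f : U -> V -> W).
Hypotheses (fl : forall v, linear (f^~ v)) (fr : forall u, linear (f u)).

Definition tensor_lift : tensor -> W :=
  lquot_lift (linext (fun t : U * V => f t.1 t.2)).

Let f_pure u v : linext (fun t : U * V => f t.1 t.2) (pure u v) = f u v.
Proof. exact: linextU. Qed.

Let f_rel p q : bilinear_rel p q ->
  linext (fun t : U * V => f t.1 t.2) p = linext (fun t => f t.1 t.2) q.
Proof.
have fr0 u : f u 0 = 0.
  by have := fr u (-1) 0 0; rewrite scaler0 addr0 scaleN1r addNr.
have fl0 v : f 0 v = 0.
  by have := fl v (-1) 0 0; rewrite scaler0 addr0 scaleN1r addNr.
case=> [u u' v|u v v'|k u v|k u v].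
- rewrite linearD /=; apply: (etrans (f_pure _ _)).
  apply: (etrans _ (esym (congr2 +%R (f_pure _ _) (f_pure _ _)))).
  by have := fl v 1 u u'; rewrite !scale1r.
- rewrite linearD /=; apply: (etrans (f_pure _ _)).
  apply: (etrans _ (esym (congr2 +%R (f_pure _ _) (f_pure _ _)))).
  by have := fr u 1 v v'; rewrite !scale1r.
- rewrite linearZ /=; apply: (etrans (f_pure _ _)).
  apply: (etrans _ (esym (congr1 _ (f_pure _ _)))).
  by have := fl v k u 0; rewrite fl0 !addr0.
- rewrite linearZ /=; apply: (etrans (f_pure _ _)).
  apply: (etrans _ (esym (congr1 _ (f_pure _ _)))).
  by have := fr u k v 0; rewrite fr0 !addr0.
Qed.

Lemma tensor_liftE u v : tensor_lift (tens u v) = f u v.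
Proof. exact: etrans (lquot_liftE f_rel _) (f_pure _ _). Qed.

Lemma tensor_lift_linear : linear tensor_lift.
Proof. exact: (lquot_lift_linear f_rel). Qed.

End Lift.

End Tensor.

(* Quotient of an algebra by the two-sided ideal generated by the p - q with
   rel p q.  The quotient is only given a pzRingType and an lmodType structure:
   mathcomp's algType demands 1 != 0, which need not hold here. *)
Section AlgebraQuotient.
Variables (K : pzRingType) (A : algType K) (rel : A -> A -> Prop).

Inductive ideal_rel : A -> A -> Prop :=
| IdealRel a p q b : rel p q -> ideal_rel (a * p * b) (a * q * b).

Definition algquot := lquot ideal_rel.
HB.instance Definition _ := GRing.Lmodule.on algquot.

Local Notation cong := (lcong ideal_rel).

Definition api (p : A) : algquot := lpi ideal_rel p.
Fact api_is_linear : linear api. Proof. exact: lpi_is_linear. Qed.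
HB.instance Definition _ :=
  GRing.isLinear.Build K A algquot *:%R api api_is_linear.

Lemma api_eq p q : api p = api q <-> cong p q.
Proof. exact: lpi_eq. Qed.

Lemma algquot_rel p q : rel p q -> api p = api q.
Proof.
move=> pq; apply/api_eq/lcong_rel.
by have := IdealRel 1 1 pq; rewrite !mul1r !mulr1.
Qed.

Lemma cong_mull a p q : cong p q -> cong (a * p) (a * q).
Proof.
elim=> {p q} [_ _ [a' p q b pq]|p|p q _|p q r _ pq _ qr|p q p' q' _ e _ e'|k p q _].
- by rewrite !mulrA; apply/lcong_rel/IdealRel.
- exact: lcong_refl.
- exact: lcong_sym.
- exact: lcong_trans qr.
- by rewrite !mulrDr; apply: lcong_add.
- by rewrite -!scalerAr; apply: lcong_scale.
Qed.

Lemma cong_mulr b p q : cong p q -> cong (p * b) (q * b).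
Proof.
elim=> {p q} [_ _ [a p q b' pq]|p|p q _|p q r _ pq _ qr|p q p' q' _ e _ e'|k p q _].
- by rewrite -!mulrA !(mulrA a); apply/lcong_rel/IdealRel.
- exact: lcong_refl.
- exact: lcong_sym.
- exact: lcong_trans qr.
- by rewrite !mulrDl; apply: lcong_add.
- by rewrite -!scalerAl; apply: lcong_scale.
Qed.

Lemma algquotP (P : algquot -> Prop) : (forall p, P (api p)) -> forall a, P a.
Proof. exact: lquotP. Qed.

Definition algquot_one : algquot := api 1.
Definition algquot_mul : algquot -> algquot -> algquot :=
  locked_with lquot_key (fun a b => api (repr a * repr b)).

Lemma algquot_pi_mul p q : algquot_mul (api p) (api q) = api (p * q).
Proof.
rewrite /algquot_mul unlock.
apply/api_eq; apply: (lcong_trans (q := p * repr (api q))).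
  exact/cong_mulr/lcong_repr.
exact/cong_mull/lcong_repr.
Qed.

Fact algquot_mulA : associative algquot_mul.
Proof.
by elim/algquotP=> p; elim/algquotP=> q; elim/algquotP=> r; rewrite !algquot_pi_mul mulrA.
Qed.
Fact algquot_mul1r : left_id algquot_one algquot_mul.
Proof. by elim/algquotP=> p; rewrite algquot_pi_mul mul1r. Qed.
Fact algquot_mulr1 : right_id algquot_one algquot_mul.
Proof. by elim/algquotP=> p; rewrite algquot_pi_mul mulr1. Qed.
Fact algquot_mulDl : left_distributive algquot_mul +%R.
Proof.
elim/algquotP=> p; elim/algquotP=> q; elim/algquotP=> r.
by rewrite -linearD !algquot_pi_mul -linearD mulrDl.
Qed.
Fact algquot_mulDr : right_distributive algquot_mul +%R.
Proof.
elim/algquotP=> p; elim/algquotP=> q; elim/algquotP=> r.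
by rewrite -linearD !algquot_pi_mul -linearD mulrDr.
Qed.

HB.instance Definition _ := GRing.Zmodule_isPzRing.Build algquot
  algquot_mulA algquot_mul1r algquot_mulr1 algquot_mulDl algquot_mulDr.

Lemma apiM : {morph api : p q / p * q}.
Proof. by move=> p q; rewrite -algquot_pi_mul. Qed.
Lemma api1 : api 1 = 1. Proof. by []. Qed.

Lemma apiZ k p : api (k *: p) = k *: api p. Proof. exact: linearZ. Qed.

Lemma algquot_scalerAl (k : K) (a b : algquot) : k *: (a * b) = k *: a * b.
Proof.
elim/algquotP: a => p; elim/algquotP: b => q.
by rewrite -apiZ -!apiM -apiZ scalerAl.
Qed.
Lemma algquot_scalerAr (k : K) (a b : algquot) : k *: (a * b) = a * (k *: b).
Proof.
elim/algquotP: a => p; elim/algquotP: b => q.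
by rewrite -apiZ -!apiM -apiZ scalerAr.
Qed.

End AlgebraQuotient.

(* Universal property of the quotient, for algebra homomorphisms to another
   quotient. *)
Section AlgebraLift.
Variables (K : pzRingType) (A A' : algType K).
Variables (rel : A -> A -> Prop) (rel' : A' -> A' -> Prop).
Variable f : {linear A -> algquot rel'}.

Definition alg_lift (a : algquot rel) : algquot rel' := f (repr a).

Hypothesis fM : {morph f : p q / p * q}.
Hypothesis f_rel : forall p q, rel p q -> f p = f q.

Lemma alg_liftE p : alg_lift (api rel p) = f p.
Proof.
apply: (linear_lcong (rel := ideal_rel rel)); last exact: lcong_repr.
by move=> _ _ [a p1 q1 b pq]; rewrite !fM (f_rel pq).
Qed.

Lemma alg_lift_linear : linear alg_lift.
Proof.
move=> k; elim/algquotP=> p; elim/algquotP=> q.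
by rewrite -apiZ -[_ + _](linearD (api rel)) !alg_liftE linearP.
Qed.

Lemma alg_liftM : {morph alg_lift : a b / a * b}.
Proof.
elim/algquotP=> p; elim/algquotP=> q.
by rewrite -apiM !alg_liftE fM.
Qed.

End AlgebraLift.

Lemma malg_scalerAr (K : comNzRingType) (M : monomType) (k : K)
  (p q : {malg K[M]}) : k *: (p * q) = p * (k *: q).
Proof.
apply/malgP => m; rewrite mcoeffZ mcoeffMl.
rewrite (@mcoeffMlw _ _ (msupp p) (msupp q)) ?msuppZ_le //.
rewrite mulr_sumr; apply: eq_bigr => m1 _.
rewrite mulr_sumr; apply: eq_bigr => m2 _.
by rewrite mcoeffZ mulrnAr mulrCA.
Qed.

(* The free associative algebra on I, and algebras by generators and relations. *)
Section Presentation.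
Variables (K : comNzRingType) (I : choiceType).

Definition freealg := {malg K[{fmonom I}]}.
HB.instance Definition _ := GRing.Lalgebra.on freealg.

HB.instance Definition _ :=
  GRing.Lalgebra_isAlgebra.Build K freealg
    (@malg_scalerAr K {fmonom I}).

Definition fgen (i : I) : freealg := << fmu i >>.

Variable rel : freealg -> freealg -> Prop.

Definition presalg := algquot rel.
HB.instance Definition _ := GRing.Lmodule.on presalg.
HB.instance Definition _ := GRing.PzRing.on presalg.

Definition pgen (i : I) : presalg := api rel (fgen i).

End Presentation.

Arguments fgen K {I} i.

Lemma linextM (K : comNzRingType) (M : monomType) (A : algType K)
    (rel : A -> A -> Prop) (b : M -> algquot rel) :
  {morph b : m1 m2 / mmul m1 m2 >-> m1 * m2} ->
  {morph linext b : p q / p * q}.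
Proof.
move=> bM p q; rewrite [p * q]malgME raddf_sum [in RHS]/linext mulr_suml.
apply: eq_bigr => m1 _; rewrite raddf_sum /= mulr_sumr; apply: eq_bigr => m2 _.
have -> : << p@_m1 * q@_m2 *g mmul m1 m2 >> =
          (p@_m1 * q@_m2) *: << mmul m1 m2 >> :> {malg K[M]}.
  by apply/malgP=> m; rewrite mcoeffZ !mcoeffU mulr_natr.
rewrite linearZ /= linextU bM.
by rewrite -algquot_scalerAl -algquot_scalerAr scalerA.
Qed.

(* Extension of a map I -> B on generators to algebra homomorphisms. *)
Section PresentationLift.
Variables (K : comNzRingType) (I : choiceType).
Variables (A : algType K) (relB : A -> A -> Prop).
Local Notation B := (algquot relB).
Variable g : I -> B.

Definition free_lift : freealg K I -> B :=
  linext (fun m : {fmonom I} => \prod_(i <- (m : seq I)) g i).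

Fact free_lift_is_linear : linear free_lift. Proof. exact: linext_is_linear. Qed.
HB.instance Definition _ :=
  GRing.isLinear.Build K (freealg K I) B *:%R free_lift free_lift_is_linear.

Lemma free_lift1 : free_lift 1 = 1.
Proof.
by rewrite [1]/(<< (mone : {fmonom I}) >> : {malg K[_]}) /free_lift linextU fm1 big_nil.
Qed.

Lemma free_lift_gen i : free_lift (fgen K i) = g i.
Proof. by rewrite /free_lift linextU fmU big_seq1. Qed.

Lemma free_liftM : {morph free_lift : p q / p * q}.
Proof. by apply: linextM => m1 m2; rewrite fmM big_cat. Qed.

Variable rel : freealg K I -> freealg K I -> Prop.

Definition pres_lift : presalg rel -> B := alg_lift free_lift.

Hypothesis g_rel : forall p q, rel p q -> free_lift p = free_lift q.

Lemma pres_liftE p : pres_lift (api rel p) = free_lift p.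
Proof. exact: alg_liftE free_liftM g_rel _. Qed.

Lemma pres_lift_gen i : pres_lift (pgen rel i) = g i.
Proof. exact: etrans (pres_liftE _) (free_lift_gen _). Qed.

Lemma pres_lift_linear : linear pres_lift.
Proof. exact: alg_lift_linear free_liftM g_rel. Qed.

Lemma pres_liftM : {morph pres_lift : a b / a * b}.
Proof. exact: alg_liftM free_liftM g_rel. Qed.

Lemma pres_lift1 : pres_lift 1 = 1.
Proof. exact: etrans (pres_liftE _) free_lift1. Qed.

End PresentationLift.

Arguments pres_lift {K I A relB} g {rel} a.

(* The group generated by I subject to the relations i^2 = 1 (i : I) and
   v = w (rel v w).  As the generators are involutions, its elements are
   represented by words, and the inverse is given by reversal. *)
Section InvolutionGroup.
Variables (I : choiceType) (rel : seq I -> seq I -> Prop).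

Inductive wcong : seq I -> seq I -> Prop :=
| wcong_rel v w : rel v w -> wcong v w
| wcong_invol i : wcong [:: i; i] [::]
| wcong_refl v : wcong v v
| wcong_sym v w : wcong v w -> wcong w v
| wcong_trans v w t : wcong v w -> wcong w t -> wcong v t
| wcong_cat v w v' w' : wcong v w -> wcong v' w' -> wcong (v ++ v') (w ++ w').

Let wcongb v w := `[< wcong v w >].

Fact wcongb_refl : reflexive wcongb.
Proof. by move=> v; apply/asboolP/wcong_refl. Qed.
Fact wcongb_sym : symmetric wcongb.
Proof. by move=> v w; apply/asboolP/asboolP => /wcong_sym. Qed.
Fact wcongb_trans : transitive wcongb.
Proof.
by move=> v w t /asboolP e /asboolP e'; apply/asboolP; apply: wcong_trans e'.
Qed.

Definition wcong_equiv := EquivRel wcongb wcongb_refl wcongb_sym wcongb_trans.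

Definition invgroup := {eq_quot wcong_equiv}.
HB.instance Definition _ := Choice.on invgroup.
HB.instance Definition _ := EqQuotient.on invgroup.

Definition wpi (v : seq I) : invgroup := \pi_invgroup v.

Lemma wpi_eq v w : wpi v = wpi w <-> wcong v w.
Proof.
split; first by move/eqmodP/asboolP.
by move=> e; apply/eqmodP/asboolP.
Qed.

Lemma wpi_repr (a : invgroup) : wpi (repr a) = a. Proof. exact: reprK. Qed.

Lemma wcong_repr v : wcong (repr (wpi v)) v.
Proof. by apply/wpi_eq; rewrite wpi_repr. Qed.

Lemma invgroupP (P : invgroup -> Prop) : (forall v, P (wpi v)) -> forall a, P a.
Proof. by move=> Pv a; rewrite -[a]wpi_repr. Qed.

Lemma wcong_catl v w w' : wcong w w' -> wcong (v ++ w) (v ++ w').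
Proof. by move=> e; apply: wcong_cat e; apply: wcong_refl. Qed.

Lemma wcong_catV v : wcong (v ++ rev v) [::].
Proof.
elim: v => [|i v IH]; first exact: wcong_refl.
rewrite rev_cons -cats1 /= catA -[i :: _]/([:: i] ++ (_ ++ _)).
apply: (wcong_trans (w := [:: i] ++ ([::] ++ [:: i]))); last exact: wcong_invol.
by apply/wcong_catl/wcong_cat; last exact: wcong_refl.
Qed.

Lemma wcong_Vcat v : wcong (rev v ++ v) [::].
Proof. by have := wcong_catV (rev v); rewrite revK. Qed.

Definition invgroup_one : invgroup := wpi [::].
Definition invgroup_mul (a b : invgroup) : invgroup := wpi (repr a ++ repr b).
Definition invgroup_inv (a : invgroup) : invgroup := wpi (rev (repr a)).

Lemma wpi_cat v w : invgroup_mul (wpi v) (wpi w) = wpi (v ++ w).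
Proof. by apply/wpi_eq/wcong_cat; apply: wcong_repr. Qed.

Fact invgroup_mulA : associative invgroup_mul.
Proof.
by elim/invgroupP=> v; elim/invgroupP=> w; elim/invgroupP=> t;
  rewrite !wpi_cat catA.
Qed.
Fact invgroup_mul1g : left_id invgroup_one invgroup_mul.
Proof. by elim/invgroupP=> v; rewrite wpi_cat. Qed.
Fact invgroup_mulg1 : right_id invgroup_one invgroup_mul.
Proof. by elim/invgroupP=> v; rewrite wpi_cat cats0. Qed.
Fact invgroup_mulVg : left_inverse invgroup_one invgroup_inv invgroup_mul.
Proof.
by move=> a; rewrite -{2}[a]wpi_repr wpi_cat; apply/wpi_eq/wcong_Vcat.
Qed.
Fact invgroup_mulgV : right_inverse invgroup_one invgroup_inv invgroup_mul.
Proof.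
by move=> a; rewrite -{1}[a]wpi_repr wpi_cat; apply/wpi_eq/wcong_catV.
Qed.

HB.instance Definition _ := isGroup.Build invgroup invgroup_mulA
  invgroup_mul1g invgroup_mulg1 invgroup_mulVg invgroup_mulgV.

End InvolutionGroup.

(* The Weyl groups of types D_n and B_n by generators and relations, the
   relations s_i^2 = 1 being built in invgroup.
   Indices are 0-based: the i-th letter, i : 'I_n, stands for s_{i+1}. *)
Section WeylGroups.
Variable n : nat.
Implicit Types i j l : 'I_n.

Inductive symm_rel : seq 'I_n -> seq 'I_n -> Prop :=
| symm_braid i j : j = i.+1 :> nat -> (j.+1 < n)%N ->
    symm_rel [:: i; j; i] [:: j; i; j]
| symm_comm i j : (i.+1 < j)%N -> (j.+1 < n)%N ->
    symm_rel [:: i; j] [:: j; i].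

Inductive weylD_rel : seq 'I_n -> seq 'I_n -> Prop :=
| weylD_symm v w : symm_rel v w -> weylD_rel v w
| weylD_comm i l : l.+1 = n -> i.+3 <> n -> weylD_rel [:: i; l] [:: l; i]
| weylD_braid i l : l.+1 = n -> i.+3 = n ->
    weylD_rel [:: i; l; i] [:: l; i; l].

Inductive weylB_rel : seq 'I_n -> seq 'I_n -> Prop :=
| weylB_symm v w : symm_rel v w -> weylB_rel v w
| weylB_comm i l : l.+1 = n -> (i.+3 <= n)%N -> weylB_rel [:: i; l] [:: l; i]
| weylB_braid i l : l.+1 = n -> i.+2 = n ->
    weylB_rel [:: i; l; i; l; i; l; i; l] [::].

(* The adjacent transposition (i, i+1); the identity if i is the last index. *)
Definition adj_tperm i : {perm 'I_n} :=
  if insub i.+1 is Some j then tperm i j else 1%g.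

(* The permutation s_{i_1} ... s_{i_r} applied to j (rightmost letter first). *)
Definition word_act (w : seq 'I_n) j : 'I_n :=
  foldr (fun i k => adj_tperm i k) j w.

End WeylGroups.

Section Clifford.
Variables (K : comNzRingType) (n : nat).

Inductive clifford_rel (A : nzRingType) (c : 'I_n -> A) : A -> A -> Prop :=
| clifford_sq i : clifford_rel c (c i * c i) 1
| clifford_anti i j : i != j -> clifford_rel c (c i * c j) (- (c j * c i)).

Definition clifford := presalg (clifford_rel (fgen K : 'I_n -> freealg K 'I_n)).
HB.instance Definition _ := GRing.Lmodule.on clifford.
HB.instance Definition _ := GRing.PzRing.on clifford.

End Clifford.

Lemma prod_exprD (R : pzRingType) (n : nat) (x : 'I_n -> R) (a b : 'I_n -> nat) :
  (forall i j, GRing.comm (x i) (x j)) ->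
  \prod_(i < n) x i ^+ (a i + b i) =
  (\prod_(i < n) x i ^+ a i) * (\prod_(i < n) x i ^+ b i).
Proof.
move=> xC; elim: (index_enum _) => [|i r IH]; first by rewrite !big_nil mulr1.
have C : GRing.comm (x i ^+ b i) (\prod_(j <- r) x j ^+ a j).
  by apply: commr_prod => j _; apply/commrX/commr_sym/commrX/xC.
by rewrite !big_cons IH exprD !mulrA -(mulrA (x i ^+ a i)) C !mulrA.
Qed.

(* Indices are 0-based here too: s_n is fs l with l.+1 = n. *)
Section HeckeClifford.
Variables (K : numClosedFieldType) (n : nat).
Implicit Types i j l : 'I_n.

Definition hgen := ('I_n + 'I_n + 'I_n)%type.
Local Notation F := (freealg K hgen).

Definition fx i : F := fgen K (inl (inl i) : hgen).
Definition fc i : F := fgen K (inl (inr i) : hgen).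
Definition fs i : F := fgen K (inr i : hgen).
Definition fsword (w : seq 'I_n) : F := \prod_(i <- w) fs i.

(* The defining relations; hc_sc, for w a word in s_1, ..., s_{n-1}, is
   sigma c_i = c_{sigma(i)} sigma for sigma in S_n.  Here W is the set of
   relations of the Weyl group other than s_i^2 = 1, and special
   is the set of relations between s_n and the x_i, c_i. *)
Section Common.
Variables (u : K) (W : seq 'I_n -> seq 'I_n -> Prop) (special : F -> F -> Prop).

Inductive hc_rel : F -> F -> Prop :=
| hc_invol i : hc_rel (fs i * fs i) 1
| hc_weyl v w : W v w -> hc_rel (fsword v) (fsword w)
| hc_cliff p q : clifford_rel fc p q -> hc_rel p q
| hc_xx i j : hc_rel (fx i * fx j) (fx j * fx i)
| hc_xc i : hc_rel (fx i * fc i) (- (fc i * fx i))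
| hc_xc_ne i j : i != j -> hc_rel (fx i * fc j) (fc j * fx i)
| hc_sc w i : all (fun k : 'I_n => (k.+1 < n)%N) w ->
    hc_rel (fsword w * fc i) (fc (word_act w i) * fsword w)
| hc_xs i j : j = i.+1 :> nat ->
    hc_rel (fx j * fs i - fs i * fx i) (u *: (1 - fc j * fc i))
| hc_xs_ne i j : (i.+1 < n)%N -> j <> i :> nat -> j <> i.+1 :> nat ->
    hc_rel (fx j * fs i) (fs i * fx j)
| hc_special p q : special p q -> hc_rel p q.

Definition hcalg := presalg hc_rel.
HB.instance Definition _ := GRing.Lmodule.on hcalg.
HB.instance Definition _ := GRing.PzRing.on hcalg.

Definition hx i : hcalg := api hc_rel (fx i).
Definition hc i : hcalg := api hc_rel (fc i).
Definition hs i : hcalg := api hc_rel (fs i).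

Definition hmon (alpha : 'X_{1..n}) : hcalg := \prod_(i < n) hx i ^+ alpha i.
Definition hcliff (eps : {ffun 'I_n -> bool}) : hcalg := \prod_(i < n) hc i ^+ eps i.
Definition hweyl (w : invgroup W) : hcalg := \prod_(i <- repr w) hs i.

Lemma hweylE v : hweyl (wpi W v) = \prod_(i <- v) hs i.
Proof.
suff H t t' : wcong W t t' -> \prod_(i <- t) hs i = \prod_(i <- t') hs i.
  exact/H/wcong_repr.
elim=> {t t'} //.
- move=> t t' W_tt'.
  have E r : \prod_(i <- r) hs i = api hc_rel (fsword r).
    by rewrite /fsword (big_morph _ (@apiM _ _ hc_rel) (api1 hc_rel)).
  by rewrite !E; apply/algquot_rel/hc_weyl.
- move=> i; rewrite !big_cons big_nil mulr1 -apiM.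
  exact/algquot_rel/hc_invol.
- by move=> t t' r _ -> _ ->.
- by move=> t t' r r' _ e _ e'; rewrite !big_cat /= e e'.
Qed.

Lemma hweylM : {morph hweyl : v w / (v * w)%g >-> v * w}.
Proof.
elim/invgroupP=> v; elim/invgroupP=> w.
by rewrite [(_ * _)%g]wpi_cat !hweylE big_cat.
Qed.

Lemma hweyl1 : hweyl 1%g = 1.
Proof. by rewrite [1%g]/(wpi W [::]) hweylE big_nil. Qed.

(* The natural homomorphisms from K[x_1, ..., x_n], C_n and K W, the last one
   being the space of finitely supported functions on W.  The notations
   'X_{1..n} and {mpoly K[n]} are those of monalg: {cmonom 'I_n}, and the monoid
   algebra over it. *)
Definition poly_to_hc (p : {mpoly K[n]}) : hcalg := linext hmon p.
Definition cliff_to_hc : clifford K n -> hcalg := pres_lift hc.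
Definition weyl_to_hc (f : {malg K[invgroup W]}) : hcalg := linext hweyl f.

Lemma hx_comm i j : GRing.comm (hx i) (hx j).
Proof. by rewrite /GRing.comm -!apiM; apply/algquot_rel/hc_xx. Qed.

Lemma hmonM : {morph hmon : m1 m2 / mmul m1 m2 >-> m1 * m2}.
Proof.
move=> m1 m2; rewrite /hmon -(prod_exprD _ _ hx_comm).
by apply: eq_bigr => i _; rewrite cmM.
Qed.

Lemma poly_to_hcM : {morph poly_to_hc : p q / p * q}.
Proof. exact: linextM hmonM. Qed.

Lemma poly_to_hcX (m : 'X_{1..n}) : poly_to_hc << m >> = hmon m.
Proof. exact: linextU. Qed.

Lemma cliff_to_hc_rel p q :
  clifford_rel (fgen K : 'I_n -> freealg K 'I_n) p q ->
  free_lift hc p = free_lift hc q.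
Proof.
case=> [i|i j ij]; rewrite ?linearN /= !free_liftM ?free_lift1 !free_lift_gen.
  by rewrite -apiM; apply/algquot_rel/hc_cliff/clifford_sq.
rewrite -!apiM -linearN.
exact/algquot_rel/hc_cliff/clifford_anti.
Qed.

Lemma cliff_to_hc_gen i : cliff_to_hc (pgen _ i) = hc i.
Proof. exact: (pres_lift_gen cliff_to_hc_rel). Qed.

Lemma cliff_to_hcM : {morph cliff_to_hc : a b / a * b}.
Proof. exact: (pres_liftM cliff_to_hc_rel). Qed.

(* The linear map from the tensor product of K[x_1, ..., x_n], C_n and K W
   induced by multiplication exists and is an isomorphism. *)
Definition mult_iso : Prop :=
  exists f : {linear tensor (tensor {mpoly K[n]} (clifford K n))
                            {malg K[invgroup W]} -> hcalg},
    (forall p a g, f (tens (tens p a) g) =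
       poly_to_hc p * cliff_to_hc a * weyl_to_hc g)
    /\ bijective f.

Definition pbw_basis : Prop :=
  is_basis (fun t : 'X_{1..n} * {ffun 'I_n -> bool} * invgroup W =>
    let: (alpha, eps, w) := t in hmon alpha * hcliff eps * hweyl w).

End Common.

Inductive hcD_special (u : K) : F -> F -> Prop :=
| hcD_c i l : l.+1 = n -> i.+2 = n -> hcD_special u (fs l * fc l) (- (fc i * fs l))
| hcD_c_ne i l : l.+1 = n -> i.+1 <> n -> i.+2 <> n ->
    hcD_special u (fs l * fc i) (fc i * fs l)
| hcD_x i l : l.+1 = n -> i.+2 = n ->
    hcD_special u (fs l * fx l + fx i * fs l) (- u *: (1 + fc i * fc l))
| hcD_x_ne i l : l.+1 = n -> i.+1 <> n -> i.+2 <> n ->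
    hcD_special u (fs l * fx i) (fx i * fs l).

Inductive hcB_special (v : K) : F -> F -> Prop :=
| hcB_c l : l.+1 = n -> hcB_special v (fs l * fc l) (- (fc l * fs l))
| hcB_c_ne i l : l.+1 = n -> i.+1 <> n ->
    hcB_special v (fs l * fc i) (fc i * fs l)
| hcB_x l : l.+1 = n ->
    hcB_special v (fs l * fx l + fx l * fs l) (- (sqrtC 2 * v)%:A)
| hcB_x_ne i l : l.+1 = n -> i.+1 <> n ->
    hcB_special v (fs l * fx i) (fx i * fs l).

End HeckeClifford.

Arguments weylD_rel n : clear implicits.
Arguments weylB_rel n : clear implicits.
Arguments hcD_special {K} n u.
Arguments hcB_special {K} n v.

(* Main.v *)
Require Import Defs.
From mathcomp Require Import all_boot all_order all_algebra.
From mathcomp Require Import complex reals.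
From HB Require Import structures.
From mathcomp Require Import all_fingroup finmap generic_quotient monalg boolp.
From mathcomp Require Import ring zify.

(* The vector space M with basis the symbols x^a c^e w is made into a module
   over the Hecke-Clifford algebra H: the x_j and c_j act by left multiplication,
   and s = s_i acts by s w = s_i w on the group part and by the rule
   s (f m) = s(f) (s m) + d(f) m, where f -> s(f) is the signed permutation of
   the x_j and c_j induced by s_i, and d is the corresponding twisted derivation.
   The relations s_i^2 = 1 and the braid relations hold on the group part; they
   extend to M because the lower order terms produced by moving an x_j through
   both sides of a relation agree.  The map M -> H sending a symbol to the
   corresponding product is H-linear, and so is H -> M, h |-> h 1; both composites
   fix a generator, so the two maps are mutually inverse.  Finally, the basis
   statement gives the tensor product statement, since the c^e span C_n. *)

Set Implicit Arguments.
Unset Strict Implicit.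
Unset Printing Implicit Defensive.

Import GRing.Theory Num.Theory.
Local Open Scope ring_scope.

(** * Rank two relations, up to lower order terms *)

(** Straightening words gives spanning; the difficulty is linear independence, and a module on which
    the symbols stay independent settles it. The obstacle is that s is given only by a recursion
    along words in the x_j and c_j, so its existence has to be proved. This is done by letting
    suitable operators on M x M satisfy the relations of the x_j and c_j, and using that M is free
    over the algebra of these relations. From then on M is known through two properties, uniqueness
    ([pbw_induction]) and existence ([pbw_extension]) of linear maps out of it. Identities between
    operators all follow by one induction: they hold at the vectors [vac w], and if they hold at m,
    they hold at x_k m and c_k m. This is why the rank two lemmas assume a relation at a single
    vector m and conclude it at x m. The group W enters only through its presentation: at [vac w]
    the s_i are left multiplications, so every relation of W holds there. *)

Section ReflectionSteps.
Variables (K : comNzRingType) (N : lmodType K).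
Variables (s t : {linear N -> N}).
Implicit Types x y z : {linear N -> N}.

(** The operators x, y are permuted by s up to the lower order terms A, B. The leading term of
    [s (s (x m))] is [x (s (s m))], and the two lower order terms cancel. The lemmas of this section
    all have this form: leading terms agree by the relation at m, and the other hypotheses match the
    lower order terms. *)
Lemma invol_step x y (A B : N -> N) m :
  (forall m, s (x m) = y (s m) + A m) -> (forall m, s (y m) = x (s m) + B m) ->
  s (A m) = - B (s m) ->
  s (s m) = m -> s (s (x m)) = x m.
Proof.
move=> sx sy sA ssm.
by rewrite sx linearD /= sy sA ssm addrK.
Qed.

Lemma comm_step x y x' y' (A A' B B' : N -> N) m :
  (forall m, s (x m) = y (s m) + A m) -> (forall m, t (x m) = y' (t m) + B m) ->
  (forall m, s (y' m) = x' (s m) + A' m) -> (forall m, t (y m) = x' (t m) + B' m) ->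
  t (A m) = A' (t m) -> s (B m) = B' (s m) ->
  s (t m) = t (s m) -> s (t (x m)) = t (s (x m)).
Proof.
move=> sx tx sy ty tA sB e.
by rewrite tx sx !linearD /= sy ty sB tA e addrAC.
Qed.

(** Along the chain x, y, z both sides carry x to z. The correction from the first crossing on one
    side equals the correction from the second crossing on the other. *)
Lemma braid3_end x y z (A B : N -> N) m :
  (forall m, s (x m) = y (s m) + A m) -> (forall m, t (x m) = x (t m)) ->
  (forall m, t (y m) = z (t m) + B m) -> (forall m, s (z m) = z (s m)) ->
  s (t (A m)) = B (s (t m)) -> s (B (s m)) = t (A (t m)) ->
  s (t (s m)) = t (s (t m)) -> s (t (s (x m))) = t (s (t (x m))).
Proof.
move=> sx tx ty sz stA sB e.
rewrite tx !sx !linearD /= !ty !linearD /= sz sB stA e -!addrA.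
by congr (_ + _); rewrite addrC.
Qed.

(** The middle operator y returns to itself, through x on the left and through z on the right. *)
Lemma braid3_mid x y z (A A' B B' : N -> N) m :
  (forall m, s (x m) = y (s m) + A m) -> (forall m, s (y m) = x (s m) + A' m) ->
  (forall m, t (y m) = z (t m) + B m) -> (forall m, t (z m) = y (t m) + B' m) ->
  (forall m, t (x m) = x (t m)) -> (forall m, s (z m) = z (s m)) ->
  s (t (A' m)) = B' (s (t m)) -> t (s (B m)) = A (t (s m)) ->
  s (t (s m)) = t (s (t m)) -> s (t (s (y m))) = t (s (t (y m))).
Proof.
move=> sx sy ty tz tx sz stA tsB e.
rewrite sy ty !linearD /= tx sz sx tz stA tsB e -!addrA.
by congr (_ + _); rewrite addrC.
Qed.

(** Both sides carry x to -x, crossing y once. The scalar terms [k *: s (s (t m))] and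
    [k *: t (s (s m))] so produced meet because s is an involution. *)
Lemma braid4_fix x y (A A' : N -> N) (k : K) m :
  (forall m, s (s m) = m) ->
  (forall m, s (x m) = y (s m) + A m) -> (forall m, s (y m) = x (s m) + A' m) ->
  (forall m, t (x m) = x (t m)) -> (forall m, t (y m) = - y (t m) + k *: m) ->
  s (t (A (t m))) = - t (A' (t (s m))) -> t (s (t (A m))) = - A' (t (s (t m))) ->
  s (t (s (t m))) = t (s (t (s m))) ->
  s (t (s (t (x m)))) = t (s (t (s (x m)))).
Proof.
move=> ss sx sy tx ty e1 e2 e.
rewrite tx !sx !linearD /= !ty !linearD /= !linearN !linearZ /= ss.
rewrite !sy e1 e2 [t (_ + _)]linearD /= tx ss e !opprD -!addrA; congr (_ + _).
by rewrite addrCA [RHS]addrCA; congr (_ + _); apply: addrC.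
Qed.

Lemma braid4_neg x y (A A' : N -> N) (k : K) m :
  (forall m, s (x m) = y (s m) + A m) -> (forall m, s (y m) = x (s m) + A' m) ->
  (forall m, t (x m) = x (t m)) -> (forall m, t (y m) = - y (t m) + k *: m) ->
  s (t (A' (t m))) = - t (A (t (s m))) -> t (s (t (A' m))) = - A (t (s (t m))) ->
  s (t (s (t m))) = t (s (t (s m))) ->
  s (t (s (t (y m)))) = t (s (t (s (y m)))).
Proof.
move=> sx sy tx ty e1 e2 e.
rewrite ty sy !linearD /= !linearN !linearZ /= sy !linearD /=
  e1 e2 !tx !sx [t (_ + _)]linearD /= ty e !opprD opprK -!addrA.
congr (_ + _); rewrite addrC -addrA addrC -!addrA.
by congr (_ + _); rewrite addrC.
Qed.

End ReflectionSteps.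

Section Reflections.
Variables (K : comNzRingType) (N : lmodType K) (u : K).
Implicit Types x y z c d e s t : {linear N -> N}.

Definition fixes s x c :=
  (forall m, s (x m) = x (s m)) /\ (forall m, s (c m) = c (s m)).

(* Solving x_{i+1} s - s x_i = u (1 - c_{i+1} c_i) for s x_i and, after
   conjugation by s, for s x_{i+1}, with c = c_i and d = c_{i+1}, yields
   s x_i = x_{i+1} s + dswap1 and s x_{i+1} = x_i s + dswap2. *)
Definition dswap1 c d m : N := u *: (d (c m) - m).
Definition dswap2 c d m : N := u *: (m + d (c m)).

Definition swaps s x y c d :=
  [/\ forall m, s (x m) = y (s m) + dswap1 c d m,
      forall m, s (y m) = x (s m) + dswap2 c d m,
      forall m, s (c m) = d (s m) & forall m, s (d m) = c (s m)].

Definition negates k s x c :=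
  (forall m, s (x m) = - x (s m) + k *: m) /\ (forall m, s (c m) = - c (s m)).

(** The induction step at one index: what is to be derived from [F m = H m]. *)
Definition agree (F H : N -> N) x c m := F (x m) = H (x m) /\ F (c m) = H (c m).

Section Conj.
Variables s c d : {linear N -> N}.

Lemma dswap1_conj c' d' m :
  (forall m, s (c m) = c' (s m)) -> (forall m, s (d m) = d' (s m)) ->
  s (dswap1 c d m) = dswap1 c' d' (s m).
Proof. by move=> sc sd; rewrite linearZ linearB /= sd sc. Qed.

Lemma dswap2_conj c' d' m :
  (forall m, s (c m) = c' (s m)) -> (forall m, s (d m) = d' (s m)) ->
  s (dswap2 c d m) = dswap2 c' d' (s m).
Proof. by move=> sc sd; rewrite linearZ linearD /= sd sc. Qed.

Hypothesis cd : forall m, c (d m) = - d (c m).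

(** Exchanging c and d turns d c into c d = - d c, so one correction becomes the negative of the
    other. This is the cancellation that [invol_step] asks for. *)
Lemma dswap1_swap m :
  (forall m, s (c m) = d (s m)) -> (forall m, s (d m) = c (s m)) ->
  s (dswap1 c d m) = - dswap2 c d (s m).
Proof.
by move=> sc sd; rewrite linearZ linearB /= sd sc cd -scalerN opprD addrC.
Qed.

Lemma dswap2_swap m :
  (forall m, s (c m) = d (s m)) -> (forall m, s (d m) = c (s m)) ->
  s (dswap2 c d m) = - dswap1 c d (s m).
Proof.
by move=> sc sd; rewrite linearZ linearD /= sd sc cd -scalerN opprB.
Qed.

(** The same sign change as for a swap, now because s negates d. It serves for the long generator in
    the braid relation of order four. *)
Lemma dswap1_neg m :
  (forall m, s (c m) = c (s m)) -> (forall m, s (d m) = - d (s m)) ->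
  s (dswap1 c d m) = - dswap2 c d (s m).
Proof.
by move=> sc sd; rewrite linearZ linearB /= sd sc -scalerN opprD addrC.
Qed.

Lemma dswap2_neg m :
  (forall m, s (c m) = c (s m)) -> (forall m, s (d m) = - d (s m)) ->
  s (dswap2 c d m) = - dswap1 c d (s m).
Proof.
by move=> sc sd; rewrite linearZ linearD /= sd sc -scalerN opprB.
Qed.

End Conj.

Lemma swaps_invol s x y c d m : (forall m, c (d m) = - d (c m)) ->
  swaps s x y c d -> s (s m) = m ->
  agree (s \o s) id x c m /\ agree (s \o s) id y d m.
Proof.
move=> cd [sx sy sc sd] e; split; split; rewrite /= ?(sc, sd) ?e //.
  by apply: (invol_step sx sy) => //; apply: dswap1_swap.
by apply: (invol_step sy sx) => //; apply: dswap2_swap.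
Qed.

Lemma negates_invol k s x c m : negates k s x c -> s (s m) = m ->
  agree (s \o s) id x c m.
Proof.
move=> [sx sc] e; split; last by rewrite /= sc linearN sc e opprK.
rewrite /= sx linearD linearN linearZ /= sx e.
by rewrite opprD opprK addrNK.
Qed.

Lemma swaps_comm_fixes s t x y c d m :
  swaps s x y c d -> fixes t x c -> fixes t y d -> s (t m) = t (s m) ->
  agree (s \o t) (t \o s) x c m /\ agree (s \o t) (t \o s) y d m.
Proof.
move=> [sx sy sc sd] [tx tc] [ty td] e; split; split=> /=;
  do ?by rewrite !(sc, tc, sd, td) e.
  by rewrite tx !sx linearD /= ty e; congr (_ + _); rewrite (dswap1_conj _ tc td).
by rewrite ty !sy linearD /= tx e; congr (_ + _); rewrite (dswap2_conj _ tc td).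
Qed.

Lemma negates_comm_fixes k s t x c m :
  negates k s x c -> fixes t x c -> s (t m) = t (s m) ->
  agree (s \o t) (t \o s) x c m.
Proof.
move=> [sx sc] [tx tc] e; split; last by rewrite /= tc !sc linearN tc e.
by rewrite /= tx !sx linearD linearN linearZ /= tx e.
Qed.

(** This is the pair s_{n-1}, s_n of type D. Both generators move the same two indices, so they do
    not commute for reasons of disjointness: each of the two products sends x to -x and y to -y, and
    the corrections agree because s and t both turn d c into - d c. *)
Lemma swaps_comm_opp s t x y y' c d d' m :
  (forall m, c (d m) = - d (c m)) ->
  (forall m, y' m = - y m) -> (forall m, d' m = - d m) ->
  swaps s x y c d -> swaps t x y' c d' -> s (t m) = t (s m) ->
  agree (s \o t) (t \o s) x c m /\ agree (s \o t) (t \o s) y d m.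
Proof.
move=> cd yE dE [sx sy sc sd] [tx ty tc td] e.
have {}tc m' : t (c m') = - d (t m') by rewrite tc dE.
have {}td m' : t (d m') = - c (t m').
  by apply: oppr_inj; rewrite -linearN -dE td opprK.
have tdc m' : t (d (c m')) = - d (c (t m')) by rewrite td tc linearN opprK cd.
have sdc m' : s (d (c m')) = - d (c (s m')) by rewrite sd sc cd.
(* The operator [\- x] is the common leading image of x under both products. *)
have sy' m' : s (y' m') = (\- x) (s m') + - dswap2 c d m'.
  by rewrite yE linearN sy opprD.
have sx' m' : s ((\- x) m') = y' (s m') + - dswap1 c d m'.
  by rewrite linearN /= sx opprD yE.
have {}ty m' : t (y m') = (\- x) (t m') + - dswap2 c d' m'.
  by apply: oppr_inj; rewrite -linearN -yE ty opprD !opprK.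
split; split=> /=; do ?by rewrite !(sc, tc, sd, td, linearN) /= e.
  apply: (comm_step sx tx sy' ty) => //.
    by rewrite linearZ linearB /= tdc /dswap2 -opprD scalerN addrC.
  by rewrite linearZ linearB /= !dE linearN sdc opprK /dswap2 dE -scalerN opprB.
apply: (comm_step sy ty sx' tx) => //.
  by rewrite linearZ linearD /= tdc /dswap1 -scalerN opprB.
by rewrite linearN linearZ linearD /= !dE linearN sdc opprK /dswap1 dE -scalerN opprD addrC.
Qed.

Lemma swaps_braid3 s t x y z c d e m :
  swaps s x y c d -> fixes s z e -> swaps t y z d e -> fixes t x c ->
  (forall m, s (s m) = m) -> (forall m, t (t m) = m) ->
  s (t (s m)) = t (s (t m)) ->
  [/\ agree (s \o t \o s) (t \o s \o t) x c m,
      agree (s \o t \o s) (t \o s \o t) y d m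
    & agree (s \o t \o s) (t \o s \o t) z e m].
Proof.
move=> [sx sy sc sd] [sz se] [ty tz td te] [tx tc] ss tt E.
split; split=> /=; do ?by rewrite !(sc, sd, se, tc, td, te) E.
- apply: (braid3_end sx tx ty sz) => //.
    rewrite (dswap1_conj _ (c' := c) (d' := e)) // (dswap1_conj _ (c' := d) (d' := e)) //.
  by rewrite (dswap1_conj _ (c' := c) (d' := e)) // ss
     (dswap1_conj _ (c' := c) (d' := e)) // tt.
- apply: (braid3_mid sx sy ty tz tx sz) => //.
    by rewrite (dswap2_conj _ (c' := c) (d' := e)) // (dswap2_conj _ (c' := d) (d' := e)).
  by rewrite (dswap1_conj _ (c' := c) (d' := e)) // (dswap1_conj _ (c' := c) (d' := d)).
(* Reversing the chain exchanges s with t and x with z, so the last index is the first one read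
   backwards. *)
- apply/esym; apply: (braid3_end tz sz sy tx) => //.
    by rewrite (dswap2_conj _ (c' := c) (d' := e)) // (dswap2_conj _ (c' := c) (d' := d)).
  by rewrite (dswap2_conj _ (c' := c) (d' := e)) // tt
     (dswap2_conj _ (c' := c) (d' := e)) // ss.
Qed.

Lemma swaps_braid4 k s t x y c d m :
  (forall m, c (d m) = - d (c m)) ->
  swaps s x y c d -> negates k t y d -> fixes t x c ->
  (forall m, s (s m) = m) -> (forall m, t (t m) = m) ->
  s (t (s (t m))) = t (s (t (s m))) ->
  agree (s \o t \o s \o t) (t \o s \o t \o s) x c m /\
  agree (s \o t \o s \o t) (t \o s \o t \o s) y d m.
Proof.
move=> cd [sx sy sc sd] [ty td] [tx tc] ss tt E.
have sA m' := @dswap1_swap s c d cd m' sc sd.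
have sA' m' := @dswap2_swap s c d cd m' sc sd.
have tA m' := @dswap1_neg t c d m' tc td.
have tA' m' := @dswap2_neg t c d m' tc td.
split; split=> /=.
- apply: (braid4_fix ss sx sy tx ty) => //.
    by rewrite tA tA' !tt linearN sA' !opprK.
  by rewrite tA !linearN sA' linearN tA !opprK.
- by rewrite !(sc, sd, tc, td, linearN) /= E.
- apply: (braid4_neg sx sy tx ty) => //.
    by rewrite tA tA' !tt linearN sA !opprK.
  by rewrite tA' !linearN sA linearN tA' !opprK.
by rewrite !(sc, sd, tc, td, linearN) /= E.
Qed.

End Reflections.

(** * The space with basis x^a c^e w *)

Section OrderedWords.
Variables (K : comNzRingType) (n : nat) (N : lmodType K).
Implicit Types (x c : 'I_n -> {linear N -> N}) (j k : 'I_n).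

Definition cliffpoly x c : Prop :=
  [/\ forall j k m, x j (x k m) = x k (x j m),
      forall j m, x j (c j m) = - c j (x j m),
      forall j k, j != k -> forall m, x j (c k m) = c k (x j m),
      forall j m, c j (c j m) = m
    & forall j k, j != k -> forall m, c j (c k m) = - c k (c j m)].

(** With exponents in nat this serves for x^a and, through the coercion from booleans, for c^e. The
    head of [r] acts last. *)
Definition opword x (a : 'I_n -> nat) (r : seq 'I_n) (m : N) : N :=
  foldr (fun j => iter (a j) (x j)) m r.

Definition flip (e : 'I_n -> bool) j k : bool := e k (+) (k == j).

(* The parity of the number of c_k that c_j must cross to reach its place. *)
Definition below (e : 'I_n -> bool) (r : seq 'I_n) j : bool :=
  \big[addb/false]_(k <- r | (k < j)%N) e k.

Lemma iterZ (f : {linear N -> N}) a (z : K) m :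
  iter a f (z *: m) = z *: iter a f m.
Proof. by elim: a => //= a ->; rewrite linearZ. Qed.

Lemma opwordZ x a r (z : K) m : opword x a r (z *: m) = z *: opword x a r m.
Proof. by elim: r => //= j r ->; rewrite iterZ. Qed.

Lemma eq_opword x a b r m : {in r, a =1 b} -> opword x a r m = opword x b r m.
Proof.
elim: r => //= j r IH ab; rewrite ab ?mem_head // IH // => k rk.
by rewrite ab // inE rk orbT.
Qed.

Lemma opword_incr x a r j m : (forall j k m, x j (x k m) = x k (x j m)) ->
  uniq r -> j \in r ->
  opword x (fun k => (j == k) + a k)%N r m = x j (opword x a r m).
Proof.
move=> xC; elim: r => //= k r IH /andP[kr ur]; rewrite inE.
have [-> _|jk /= jr] := eqVneq j k.
  rewrite (@eq_opword _ _ a) // => i ir.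
  by case: eqP ir kr => // -> ->.
rewrite IH //; elim: (a k) => //= b ->; exact: xC.
Qed.

Lemma opword_cx x c a r j m : cliffpoly x c -> uniq r ->
  c j (opword x a r m) = (-1) ^+ (if j \in r then a j else 0%N) *: opword x a r (c j m).
Proof.
case=> [_ xc xcn _ _]; elim: r m => [|k r IH] m /=; first by rewrite scale1r.
case/andP=> kr ur; rewrite inE.
have [?|jk] := eqVneq j k; first subst k.
  have -> b m' : c j (iter b (x j) m') = (-1) ^+ b *: iter b (x j) (c j m').
    elim: b => [|b IHb] /=; first by rewrite scale1r.
    by rewrite -[c j _]opprK -xc IHb linearZ /= exprS mulN1r scaleNr.
  by rewrite IH // (negPf kr) scale1r.
have -> b m' : c j (iter b (x k) m') = iter b (x k) (c j m').
  by elim: b => //= b <-; rewrite xcn // eq_sym.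
by rewrite IH // iterZ.
Qed.

(** As [r] is increasing, the letters in front of place j are those of smaller index, whence the
    sign [below]. A c_j already at its place is removed by c_j c_j = 1. *)
Lemma opword_flip c (e : 'I_n -> bool) r j m :
  (forall j m, c j (c j m) = m) ->
  (forall j k, j != k -> forall m, c j (c k m) = - c k (c j m)) ->
  sorted (fun i k : 'I_n => i < k)%N r -> j \in r ->
  opword c (flip e j) r m = (-1) ^+ below e r j *: c j (opword c e r m).
Proof.
move=> cc cA; elim: r => //= k r IH kr; rewrite inE.
have kr' : all (fun i : 'I_n => k < i)%N r.
  by apply: order_path_min kr => i1 i2 i3; apply: ltn_trans.
have [-> _|jk /= jr] := eqVneq j k.
  rewrite /below big_cons ltnn big_seq_cond big1 => [|i /andP[ir ik]]; last first.
    by move/allP/(_ i ir): kr'; rewrite ltnNge ltnW.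
  rewrite scale1r (@eq_opword _ _ e) => [|i ir]; last first.
    rewrite /flip; case: eqP => [ik|]; last by rewrite addbF.
    by move/allP/(_ i ir): kr'; rewrite ik ltnn.
  by rewrite /flip eqxx addbT; case: (e k) => //=.
rewrite IH ?(path_sorted kr) // /below big_cons.
have /= -> := allP kr' _ jr.
rewrite iterZ /flip [k == j]eq_sym (negPf jk) addbF signr_addb.
case: (e k) => /=; last by rewrite expr0 mul1r.
by rewrite cA 1?eq_sym // scalerN expr1 mulN1r scaleNr.
Qed.

Lemma sorted_index_enum : sorted (fun i k : 'I_n => i < k)%N (index_enum 'I_n).
Proof.
have := iota_ltn_sorted 0 n; rewrite -val_enum_ord enumT sorted_map.
by rewrite -[index_enum _]/(Finite.enum _) unlock.
Qed.

End OrderedWords.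

Lemma opword_morph (K : comNzRingType) (n : nat) (M N : lmodType K) (F : M -> N)
    (y : 'I_n -> {linear M -> M}) (y' : 'I_n -> {linear N -> N}) a r m :
  (forall j m, F (y j m) = y' j (F m)) ->
  F (opword y a r m) = opword y' a r (F m).
Proof.
move=> Fy; elim: r => //= j r <-.
by elim: (a j) => //= d <-; apply: Fy.
Qed.

Section Below.
Variable n : nat.
Implicit Types j k : 'I_n.

Lemma eq_below (e e' : 'I_n -> bool) r j : e =1 e' -> below e r j = below e' r j.
Proof. by move=> ee'; apply: eq_bigr => i _; rewrite ee'. Qed.

Lemma below_flip (e : 'I_n -> bool) j k :
  below (flip e j) (index_enum _) k = below e (index_enum _) k (+) (j < k)%N.
Proof.
rewrite /below big_split /=; congr (_ (+) _).
rewrite (eq_bigr (fun i => if i == j then true else false)); last first.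
  by move=> i _; case: (i == j).
rewrite -big_mkcondr /=.
case: ltnP => jk.
  by rewrite (big_pred1 j) // => i /=; case: eqP => [->|]; rewrite ?jk ?andbF.
rewrite big_pred0 // => i; case: eqP => [->|]; rewrite ?andbF //.
by rewrite ltnNge jk.
Qed.

End Below.

Lemma malg_ind (K : comNzRingType) (T : choiceType) (P : {malg K[T]} -> Prop) :
  P 0 -> (forall z p q, P p -> P q -> P (z *: p + q)) ->
  (forall t, P << t >>) -> forall m, P m.
Proof.
move=> P0 PD PU m; rewrite [m]monalgE; elim: (enum_fset _) => [|t r IH].
  by rewrite big_nil.
have zE z : << z *g t >> = z *: << t >> :> {malg K[T]}.
  by apply/malgP => t'; rewrite mcoeffZ !mcoeffU mulr_natr.
by rewrite big_cons zE; apply: PD.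
Qed.

Lemma eq_linear_malg (K : comNzRingType) (N : lmodType K) (T : choiceType)
    (F H : {malg K[T]} -> N) :
  linear F -> linear H -> (forall t, F << t >> = H << t >>) -> F =1 H.
Proof.
move=> Fl Hl FH; apply: malg_ind => // [|z p q Fp Fq]; last by rewrite Fl Hl Fp Fq.
have L0 (L : {malg K[T]} -> N) : linear L -> L 0 = 0.
  by move=> Ll; have := Ll (-1) 0 0; rewrite scaler0 addr0 scaleN1r addNr.
by rewrite !L0.
Qed.

Section Universal.
Variables (K : comNzRingType) (n : nat) (G : Type) (M : lmodType K).
Variables (x c : 'I_n -> {linear M -> M}) (vac : G -> M).

(** With [pbw_extension] this is the universal property of the free module on the vectors [vac w]
    over the algebra of the x_j and c_j; generation is phrased as an induction for equality of
    linear maps. *)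
Definition pbw_induction : Prop :=
  forall (N : lmodType K) (F H : M -> N), linear F -> linear H ->
  (forall w, F (vac w) = H (vac w)) ->
  (forall j m, F m = H m -> F (x j m) = H (x j m)) ->
  (forall j m, F m = H m -> F (c j m) = H (c j m)) -> F =1 H.

Definition pbw_extension : Prop :=
  forall (N : lmodType K) (x' c' : 'I_n -> {linear N -> N}) (v : G -> N),
  cliffpoly x' c' ->
  exists F : {linear M -> N},
    [/\ forall w, F (vac w) = v w, forall j m, F (x j m) = x' j (F m)
      & forall j m, F (c j m) = c' j (F m)].

End Universal.

(* The space with basis x^a c^e w, w in G, on which the x_j and c_j act by left
   multiplication and vac w is the basis vector w.  It is kept abstract, since
   unification would otherwise unfold the operations of {malg K[_]}. *)
Section Model.
Variables (K : comNzRingType) (n : nat) (G : choiceType).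
Implicit Types (j k : 'I_n) (w : G) (e : {ffun 'I_n -> bool}) (a : 'X_{1..n}).

Definition cflip e j : {ffun 'I_n -> bool} := [ffun k => flip e j k].

Lemma cflipE e j k : cflip e j k = flip e j k. Proof. exact: ffunE. Qed.

Lemma below_cflip e j k :
  below (cflip e j) (index_enum _) k = below e (index_enum _) k (+) (j < k)%N.
Proof. by rewrite -below_flip; apply: eq_below => i; rewrite cflipE. Qed.

(** The cost of moving c_j to its place in x^a c^e: among the x_k it anticommutes with x_j only, and
    it then crosses the c_k of c^e with k < j. *)
Definition csign a e j : K := (-1) ^+ (a j + below e (index_enum _) j).

Variables (M : lmodType K) (b : 'X_{1..n} -> {ffun 'I_n -> bool} -> G -> M).
Variables xop cop : 'I_n -> {linear M -> M}.
Hypothesis b_ext : forall (N : lmodType K)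
  (f : 'X_{1..n} -> {ffun 'I_n -> bool} -> G -> N),
  exists F : {linear M -> N}, forall a e w, F (b a e w) = f a e w.
Hypothesis b_uniq : forall (N : lmodType K) (F H : M -> N), linear F -> linear H ->
  (forall a e w, F (b a e w) = H (b a e w)) -> F =1 H.
Hypothesis xopE : forall j a e w, xop j (b a e w) = b (mmul (ucm j) a) e w.
Hypothesis copE : forall j a e w,
  cop j (b a e w) = csign a e j *: b a (cflip e j) w.

Definition vac w : M := b mone [ffun=> false] w.

Lemma cliffpoly_model : cliffpoly xop cop.
Proof.
split=> [j k|j|j k jk|j|j k jk].
- apply: b_uniq => [z p q|z p q|a e w]; rewrite ?linearP //.
  by rewrite !xopE; congr (b _ _ _); rewrite !mulmA (mulmC (ucm j)).
- apply: b_uniq => [z p q|z p q|a e w]; rewrite ?linearP //.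
  rewrite xopE !copE linearZ /= xopE /csign cmM cmU eqxx -scaleNr.
  by rewrite -addnA exprS mulN1r opprK.
- apply: b_uniq => [z p q|z p q|a e w]; rewrite ?linearP //.
  by rewrite xopE !copE linearZ /= xopE /csign cmM cmU (negPf jk).
- apply: b_uniq => [z p q|z p q|a e w]; rewrite ?linearP //.
  rewrite copE linearZ /= copE scalerA /csign below_cflip ltnn addbF -expr2 sqrr_sign scale1r; congr (b _ _ _).
  by apply/ffunP => i; rewrite !cflipE /flip !cflipE /flip -addbA addbb addbF.
apply: b_uniq => [z p q|z p q|a e w]; rewrite ?linearP //.
rewrite !copE !linearZ /= !copE !scalerA -scaleNr !scalerA; congr (_ *: b _ _ _); last first.
  by apply/ffunP => i; rewrite !cflipE /flip !cflipE /flip addbAC.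
rewrite /csign !below_cflip !exprD !signr_addb [RHS]mulrC.
(* Exactly one of the two orders makes the second letter cross the first; this is the single sign by
   which the sides differ. *)
have : (k < j)%N = ~~ (j < k)%N by rewrite -leqNgt ltn_neqAle eq_sym jk.
by case: (j < k)%N => ->; rewrite expr0 expr1;
  move: (_ ^+ a j) (_ ^+ a k) (_ ^+ below _ _ j) (_ ^+ below _ _ k) => * /=; ring.
Qed.

Lemma opword_xop a0 a e w r : uniq r ->
  exists2 a', opword xop a0 r (b a e w) = b a' e w
            & forall i, a' i = (a i + if i \in r then a0 i else 0)%N.
Proof.
elim: r => [_|j r IH /= /andP[jr ur]]; first by exists a => // i; rewrite addn0.
have [a' -> a'E] := IH ur.
have [a2 -> a2E] : exists2 a2, iter (a0 j) (xop j) (b a' e w) = b a2 e w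
    & forall i, a2 i = (a' i + if i == j then a0 j else 0)%N.
  elim: (a0 j) => [|k [a2 /= -> a2E]].
    by exists a' => // i; case: ifP; rewrite addn0.
  rewrite xopE; eexists; first by [].
  move=> i; rewrite cmM cmU a2E addnCA eq_sym; congr (_ + _)%N.
  by case: eqP => // ij; rewrite eqxx.
exists a2 => // i; rewrite a2E a'E inE; case: eqP => [->|_]; last by rewrite addn0.
by rewrite (negPf jr) addn0.
Qed.

(** No sign appears: the letters are applied from the largest index down, so each c_j meets larger
    indices only. *)
Lemma opword_cop e0 w r : sorted (fun i k : 'I_n => i < k)%N r ->
  opword cop (fun i => e0 i) r (vac w) = b mone [ffun i => (i \in r) && e0 i] w.
Proof.
elim: r => [_|j r IH jr] /=.
  by rewrite /vac; congr (b _ _ _); apply/ffunP => i; rewrite !ffunE.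
have jr' : all (fun i : 'I_n => j < i)%N r.
  by apply: order_path_min jr => i1 i2 i3; apply: ltn_trans.
rewrite IH ?(path_sorted jr) //.
have jnr : (j \in r) = false.
  by apply/negP => /(allP jr'); rewrite ltnn.
case E : (e0 j) => /=.
  rewrite copE /csign cm1 add0n /below big_seq_cond big1 ?scale1r.
    congr (b _ _ _); apply/ffunP => i; rewrite cflipE /flip !ffunE inE.
    by case: eqP => [->|_]; rewrite ?jnr ?E // addbF.
  move=> i /andP[_ ij]; rewrite ffunE; case: (boolP (i \in r)) => // /(allP jr').
  by rewrite ltnNge ltnW.
congr (b _ _ _); apply/ffunP => i; rewrite !ffunE inE.
by case: eqP => [->|_]; rewrite ?jnr ?E.
Qed.

Lemma opword_vac a e w :
  opword xop a (index_enum _) (opword cop (fun i => e i) (index_enum _) (vac w)) = b a e w.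
Proof.
rewrite opword_cop ?sorted_index_enum //.
have [a' -> a'E] := opword_xop a mone [ffun i => (i \in index_enum 'I_n) && e i] w
  (index_enum_uniq _).
congr (b _ _ _); first by apply/eqP/cmP => i; rewrite a'E mem_index_enum cm1.
by apply/ffunP => i; rewrite ffunE mem_index_enum.
Qed.

Lemma pbwmod_ind : pbw_induction xop cop vac.
Proof.
move=> N F H Fl Hl FHv FHx FHc; apply: b_uniq => // a e w; rewrite -opword_vac.
have FHw (y : 'I_n -> {linear M -> M}) c r m :
    (forall j m, F m = H m -> F (y j m) = H (y j m)) -> F m = H m ->
    F (opword y c r m) = H (opword y c r m).
  move=> Fy Fm; elim: r => //= j r IH; elim: (c j) => //= k; exact: Fy.
exact/FHw/FHw.
Qed.

(** By [opword_vac] the value of F on a basis vector can only be the same ordered word in N. Moving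
    c_j to its place in N produces the two factors of [csign], which cancel against those in the
    definition of [cop]. *)
Lemma pbwmod_lift : pbw_extension xop cop vac.
Proof.
move=> N x c v xc; have [xx _ _ cc cA] := xc.
have [F FE] := b_ext (fun a e w =>
  opword x a (index_enum _) (opword c (fun i => e i) (index_enum _) (v w))).
exists F; split.
- move=> w; rewrite /vac FE.
  have Z (y : 'I_n -> {linear N -> N}) d r m : {in r, d =1 fun=> 0%N} -> opword y d r m = m.
    elim: r m => //= j r IH m d0; rewrite d0 ?mem_head //= IH // => i ir.
    by apply: d0; rewrite inE ir orbT.
  by rewrite !Z // => i _; rewrite ?cm1 ?ffunE.
- move=> j; apply: b_uniq => [z p q|z p q|a e w]; rewrite ?linearP //.
  rewrite xopE !FE -opword_incr ?index_enum_uniq ?mem_index_enum //.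
  by apply: eq_opword => i _; rewrite cmM cmU.
move=> j; apply: b_uniq => [z p q|z p q|a e w]; rewrite ?linearP //.
rewrite copE linearZ /= !FE (opword_cx _ _ _ xc) ?index_enum_uniq // mem_index_enum.
rewrite (@eq_opword _ _ _ c _ (flip e j)); last by move=> i _; rewrite cflipE.
rewrite opword_flip ?sorted_index_enum ?mem_index_enum // opwordZ scalerA.
by rewrite /csign exprD -mulrA -expr2 sqrr_sign mulr1.
Qed.

End Model.

(** * The operators s_i *)

Section ReflectionData.
Variables (K : comNzRingType) (n : nat) (N : lmodType K).
Variables (x c : 'I_n -> {linear N -> N}).
Implicit Types (a b k : 'I_n) (s : {linear N -> N}).

(* The sign eta is 1 for s_1, ..., s_{n-1} and -1 for the last generator in type
   D, whose relations are those of s_{n-1} with x_n, c_n replaced by -x_n, -c_n. *)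
Definition short_refl (u : K) a b (eta : K) s : Prop :=
  swaps u s (x a) (eta \*: x b) (c a) (eta \*: c b) /\
  forall k, k != a -> k != b -> fixes s (x k) (c k).

Definition long_refl (kappa : K) b s : Prop :=
  negates kappa s (x b) (c b) /\ forall k, k != b -> fixes s (x k) (c k).

End ReflectionData.

Section Construction.
Variables (K : comNzRingType) (n : nat) (G : choiceType) (M : lmodType K).
Variables (x c : 'I_n -> {linear M -> M}) (vac : G -> M).
Hypothesis xc : cliffpoly x c.
Hypothesis M_ind : pbw_induction x c vac.
Let M_indE (N : lmodType K) (F H : M -> N) := @M_ind N F H.
Hypothesis M_lift : pbw_extension x c vac.
Let M_liftE (N : lmodType K) (x' c' : 'I_n -> {linear N -> N}) v :=
  @M_lift N x' c' v.

Implicit Types (a b j k : 'I_n) (s t : {linear M -> M}).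

Lemma triangular_op (f g : {linear M -> M}) (h : M -> M) : linear h ->
  exists F : {linear (M * M)%type -> (M * M)%type}, forall p, F p = (f p.1 + h p.2, g p.2).
Proof.
move=> hl; pose F (p : M * M) := (f p.1 + h p.2, g p.2).
have Fl : linear F.
  move=> z p q; apply: injective_projections; rewrite /= !linearP //.
  by rewrite hl -addrACA -scalerDr.
by exists (HB.pack_for {linear (M * M)%type -> (M * M)%type} F (GRing.isLinear.Build _ _ _ _ F Fl)).
Qed.

(* The twisted derivation rule s(fg) = s(f) s(g) + d(f) g says that
   f |-> [[s f, d f], [0, f]] is multiplicative, so that the rule on the
   generators defines s as soon as these matrices satisfy the relations. *)
Lemma refl_lift (sx sc : 'I_n -> {linear M -> M}) (d : 'I_n -> M -> M) (tau : G -> G) :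
  cliffpoly sx sc -> (forall k, linear (d k)) ->
  (forall j k m, sx j (d k m) + d j (x k m) = sx k (d j m) + d k (x j m)) ->
  (forall j m, d j (c j m) = - sc j (d j m)) ->
  (forall j k, j != k -> forall m, d j (c k m) = sc k (d j m)) ->
  exists s, [/\ forall w, s (vac w) = vac (tau w),
    forall j m, s (x j m) = sx j (s m) + d j m
    & forall j m, s (c j m) = sc j (s m)].
Proof.
move=> [sxx sxc sxcn scc scA] dl dx dc dcn; have [xx xc1 xcn cc cA] := xc.
have [X XE] := choice (fun j => triangular_op (sx j) (x j) (dl j)).
have zl : linear (fun _ : M => 0 : M) by move=> z p q; rewrite scaler0 addr0.
have [C CE] := choice (fun j => triangular_op (sc j) (c j) zl).
have XC : cliffpoly X C.
  split=> [j k|j|j k jk|j|j k jk] m; apply: injective_projections;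
    rewrite /= ?(XE, CE) /= ?(XE, CE) /= ?addr0 //.
  - by rewrite !linearD /= -!addrA sxx dx.
  - by rewrite sxc dc linearD opprD.
  - by rewrite sxcn // dcn // linearD.
  - by rewrite xcn.
  - by rewrite scA.
  - by rewrite cA.
(* The second coordinate reproduces m and the first records s m, so in the rule for x_j the
   correction [d j] is applied to m itself. *)
have [F [Fv Fx Fc]] := M_liftE (fun w => (vac (tau w), vac w)) XC.
have F2 m : (F m).2 = m.
  apply: (M_indE (F := fun m => (F m).2) (H := id)) => //.
  - by move=> z p q; rewrite linearP.
  - by move=> w; rewrite Fv.
  - by move=> j p e; rewrite Fx XE /= e.
  - by move=> j p e; rewrite Fc CE /= e.
pose s m := (F m).1.
have sl : linear s by move=> z p q; rewrite /s linearP.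
exists (HB.pack_for {linear M -> M} s (GRing.isLinear.Build _ _ _ _ s sl)).
split=> /= [w|j m|j m]; rewrite /s ?Fv //.
  by rewrite Fx XE /= F2.
by rewrite Fc CE /= addr0.
Qed.

Lemma cliffpoly_twist (e : 'I_n -> K) (p : 'I_n -> 'I_n) :
  injective p -> (forall k, e k * e k = 1) ->
  cliffpoly (fun k => e k \*: x (p k)) (fun k => e k \*: c (p k)).
Proof.
move=> p_inj ee; have [xx xc1 xcn cc cA] := xc.
split=> [j k|j|j k jk|j|j k jk] m /=; rewrite !linearZ /=.
- by rewrite xx scalerA mulrC -scalerA.
- by rewrite xc1 !scalerN.
- by rewrite xcn ?(inj_eq p_inj) // scalerA mulrC -scalerA.
- by rewrite cc scalerA ee scale1r.
- by rewrite cA ?(inj_eq p_inj) // scalerA mulrC -scalerA !scalerN.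
Qed.

(** Existence of s is a matter of the x_j and c_j alone, whence the arbitrary [tau]; the group law
    enters with the Coxeter relations. *)
Lemma short_refl_ex u a b eta (tau : G -> G) : a != b -> eta * eta = 1 ->
  exists s, (forall w, s (vac w) = vac (tau w)) /\ short_refl x c u a b eta s.
Proof.
move=> ab ee; have [xx xc1 xcn cc cA] := xc.
suff H (y d : {linear M -> M}) :
    (forall m, y m = eta *: x b m) -> (forall m, d m = eta *: c b m) ->
    exists s, (forall w, s (vac w) = vac (tau w)) /\
      (swaps u s (x a) y (c a) d /\
       forall k, k != a -> k != b -> fixes s (x k) (c k)) by exact: H.
move=> yE dE; have ba : b != a by rewrite eq_sym.
(* The signed permutation underlying s sends x_k to [e k] times x_{p k}, and c_k likewise. *)
pose e k : K := if (k == a) || (k == b) then eta else 1.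
have eE k : e k * e k = 1 by rewrite /e; case: ifP; rewrite ?ee ?mul1r.
pose p k := tperm a b k.
(* The factor eta at b appears because the rule of [swaps] concerns y = eta x_b, and x_b = eta y. *)
pose D k m := if k == a then dswap1 u (c a) d m
              else if k == b then eta *: dswap2 u (c a) d m else 0.
have Da m : D a m = dswap1 u (c a) d m by rewrite /D eqxx.
have Db m : D b m = eta *: dswap2 u (c a) d m by rewrite /D (negPf ba) eqxx.
have Dk k m : k != a -> k != b -> D k m = 0.
  by rewrite /D => /negPf-> /negPf->.
have ea : e a = eta by rewrite /e eqxx.
have eb : e b = eta by rewrite /e eqxx orbT.
have ek k : k != a -> k != b -> e k = 1 by rewrite /e => /negPf-> /negPf->.
have pa : p a = b by rewrite /p tpermL.
have pb : p b = a by rewrite /p tpermR.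
have pk k : k != a -> k != b -> p k = k by move=> ka kb; rewrite /p tpermD // eq_sym.
have eeK (m : M) : eta *: (eta *: m) = m by rewrite scalerA ee scale1r.
have xbE m : x b m = eta *: y m by rewrite yE eeK.
have cbE m : c b m = eta *: d m by rewrite dE eeK.
have yd m : y (d m) = - d (y m) by rewrite !yE !dE !linearZ /= xc1 !scalerN.
have yc m : y (c a m) = c a (y m) by rewrite !yE linearZ /= xcn.
have xd m : x a (d m) = d (x a m) by rewrite !dE linearZ /= xcn.
have dd m : d (d m) = m by rewrite !dE linearZ /= cc eeK.
have dc m : d (c a m) = - c a (d m) by rewrite !dE linearZ /= cA // scalerN.
have Dcomm k (f : {linear M -> M}) : k != a -> k != b -> (f = x k \/ f = c k) ->
    forall j m, D j (f m) = f (D j m).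
  move=> ka kb fE j m; have fdc : f (d (c a m)) = d (c a (f m)).
    case: fE => ->; rewrite !dE linearZ /=; first by rewrite !xcn.
    by rewrite (cA _ _ kb) (cA _ _ ka) !linearN opprK.
  rewrite /D /dswap1 /dswap2; case: ifP => _; last case: ifP => _.
  - by rewrite [f (_ *: _)]linearZ /= [f (_ + _)]linearB /= fdc.
  - by rewrite ![f (_ *: _)]linearZ /= [f (_ + _)]linearD /= fdc.
  - by rewrite linear0.
have Dl k : linear (D k).
  move=> z m m'; rewrite /D; case: ifP => _; last case: ifP => _.
  - exact: (linearP (u \*: (d \o c a \- idfun))).
  - exact: (linearP (eta \*: (u \*: (idfun \+ (d \o c a))))).
  - by rewrite scaler0 addr0.
have tw : cliffpoly (fun k => e k \*: x (p k)) (fun k => e k \*: c (p k)).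
  by apply: cliffpoly_twist => //; apply: perm_inj.
have D1Z v : dswap1 u (c a) d (eta *: v) = eta *: dswap1 u (c a) d v.
  by rewrite /dswap1 [c a _]linearZ [d _]linearZ /= -scalerBr scalerA mulrC -scalerA.
have D2Z v : dswap2 u (c a) d (eta *: v) = eta *: dswap2 u (c a) d v.
  by rewrite /dswap2 [c a _]linearZ [d _]linearZ /= -scalerDr scalerA mulrC -scalerA.
(* Compatibility with x_a x_b = x_b x_a is the case in which both indices have a correction. Each
   side vanishes by itself, since y and x_a both anticommute with d c_a. *)
have xya m : eta *: x b (eta *: dswap2 u (c a) d m) + dswap1 u (c a) d (x b m) = 0.
  rewrite -yE [y _]linearZ /= [y _]linearZ /= [y _]linearD /= yd yc.
  by rewrite xbE D1Z -scalerDr /dswap1 -scalerDr -[_ - y m]opprB subrr !scaler0.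
have xyb m : eta *: x a (dswap1 u (c a) d m) + eta *: dswap2 u (c a) d (x a m) = 0.
  rewrite [x a _]linearZ /= [x a _]linearB /= xd xc1 [d (- _)]linearN.
  by rewrite -scalerDr /dswap2 -scalerDr -opprD [X in - X]addrC addNr !scaler0.
have [j k m|j m|j k jk m|s [sv sx sc]] := refl_lift tau tw Dl.
- have [->|ja] := eqVneq j a; last have [->|jb] := eqVneq j b.
  + have [->|ka] := eqVneq k a => //; have [->|kb] := eqVneq k b => //.
      by rewrite /= Da Db ea eb pa pb Da Db xya xyb.
    by rewrite /= (Dk k) // linear0 scaler0 add0r ek // scale1r pk // (Dk k) // addr0
      (Dcomm k) //; left.
  + have [->|ka] := eqVneq k a; last have [->|kb] := eqVneq k b => //.
      by rewrite /= Da Db ea eb pa pb Da Db xya xyb.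
    by rewrite /= (Dk k) // linear0 scaler0 add0r ek // scale1r pk // (Dk k) // addr0
      (Dcomm k) //; left.
  by rewrite /= !(Dk j) // linear0 scaler0 addr0 ek // scale1r pk // add0r (Dcomm j) //; left.
- have [->|ja] := eqVneq j a; last have [->|jb] := eqVneq j b.
  + rewrite /= !Da ea pa -dE /dswap1 [d (_ *: _)]linearZ /= [d (_ - _)]linearB /=.
    by rewrite dd cc -scalerN opprB.
  + rewrite /= !Db eb pb cbE D2Z [c a (_ *: _)]linearZ /= !eeK /dswap2.
    rewrite [c a (_ *: _)]linearZ [c a (_ + _)]linearD /= !dc dd [c a (- _)]linearN cc.
    by rewrite -scalerN opprB addrC.
  by rewrite !Dk // linear0 oppr0.
- have [ja|ja] := eqVneq j a; last have [jb|jb] := eqVneq j b.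
  + have [kb|kb] := eqVneq k b.
      rewrite ja kb /= !Da eb pb cbE D1Z /dswap1 dc dd [c a (_ *: _)]linearZ /=.
      rewrite [c a (_ - _)]linearB /= !dc [c a (- _)]linearN cc.
      by rewrite [- d m - _]addrC.
    have ka : k != a by rewrite -ja eq_sym.
    by rewrite (Dcomm k) /= ?ek ?scale1r ?pk //; right.
  + have [ka|ka] := eqVneq k a.
      rewrite jb ka /= !Db ea pa -dE /dswap2 cc ![d (_ *: _)]linearZ /= [d (_ + _)]linearD /= dd.
      by rewrite addrC.
    have kb : k != b by rewrite -jb eq_sym.
    by rewrite (Dcomm k) /= ?ek ?scale1r ?pk //; right.
  by rewrite !Dk // linear0.
exists s; split=> //; split=> [|k ka kb]; split=> m.
- by rewrite sx /= ea pa Da -yE.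
- by rewrite yE [s (_ *: _)]linearZ /= sx /= eb pb Db -scalerDr eeK.
- by rewrite sc /= ea pa -dE.
- by rewrite dE [s (_ *: _)]linearZ /= sc /= eb pb eeK.
- by rewrite sx /= ek // pk // scale1r Dk // addr0.
- by rewrite sc /= ek // pk // scale1r.
Qed.

(** The correction at b is the scalar kappa. It is compatible with x_b c_b = - c_b x_b because s
    negates c_b as well: kappa c_b = - (- c_b) kappa. *)
Lemma long_refl_ex kappa b (tau : G -> G) :
  exists s, (forall w, s (vac w) = vac (tau w)) /\ long_refl x c kappa b s.
Proof.
have [xx xc1 xcn cc cA] := xc.
pose e k : K := if k == b then -1 else 1.
have eq k : e k * e k = 1 by rewrite /e; case: ifP; rewrite ?mulrNN mul1r.
have [|k||||s [sv sx sc]] := @refl_lift (fun k => e k \*: x k) (fun k => e k \*: c k)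
    (fun k m => if k == b then kappa *: m else 0) tau.
- split=> [j k|j|j k jk|j|j k jk] m /=; rewrite !linearZ /=.
  + by rewrite xx scalerA mulrC -scalerA.
  + by rewrite xc1 !scalerN.
  + by rewrite xcn // scalerA mulrC -scalerA.
  + by rewrite cc scalerA eq scale1r.
  + by rewrite cA // scalerA mulrC -scalerA !scalerN.
- move=> z p q; case: ifP => _; last by rewrite scaler0 addr0.
  by rewrite scalerDr !scalerA mulrC.
- move=> j k m /=; rewrite /e; case: eqP => [->|jb]; case: eqP => [->|kb] //;
    by rewrite ?linear0 ?scale1r ?linearZ ?scaler0 ?add0r ?addr0.
- move=> j m /=; rewrite /e; case: eqP => [->|jb]; last by rewrite linear0 scaler0 oppr0.
  by rewrite scaleN1r opprK linearZ.
- move=> j k jk m /=; rewrite /e; case: eqP => [jb|_]; last by rewrite linear0 scaler0.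
  by rewrite -jb [k == j]eq_sym (negPf jk) scale1r linearZ.
exists s; split=> //; split=> [|k kb]; split=> m; rewrite ?sx ?sc /e /=.
- by rewrite eqxx scaleN1r.
- by rewrite eqxx scaleN1r.
- by rewrite (negPf kb) scale1r addr0.
- by rewrite (negPf kb) scale1r.
Qed.
End Construction.

(** * The Coxeter relations on the whole of M *)

Section Scaling.
Variables (K : comNzRingType) (N : lmodType K).
Implicit Types (x c s : {linear N -> N}).

(** The rank two lemmas speak of the signed operators eta x_b and eta c_b, while the induction over
    M asks for x_b and c_b. *)
Lemma agree_scale (F H : N -> N) x c (eta : K) m : linear F -> linear H ->
  eta * eta = 1 -> agree F H (eta \*: x) (eta \*: c) m -> agree F H x c m.
Proof.
move=> Fl Hl ee; have Z (F' : N -> N) v : linear F' -> F' (eta *: v) = eta *: F' v.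
  move=> F'l; have F'0 : F' 0 = 0 by have := F'l (-1) 0 0; rewrite scaler0 addr0 scaleN1r addNr.
  by have := F'l eta v 0; rewrite !addr0 F'0 addr0.
rewrite /agree /= !Z // => -[e1 e2].
by split; [move: e1|move: e2] => /(congr1 ( *:%R eta)); rewrite !scalerA ee !scale1r.
Qed.

Lemma fixes_scale s x c (eta : K) : fixes s x c -> fixes s (eta \*: x) (eta \*: c).
Proof. by move=> [sx sc]; split=> m /=; rewrite linearZ /= ?sx ?sc. Qed.

End Scaling.

Section CoxeterRelations.
Variables (K : comNzRingType) (n : nat) (G : Type) (M : lmodType K).
Variables (x c : 'I_n -> {linear M -> M}) (vac : G -> M).
Hypothesis xc : cliffpoly x c.
Hypothesis M_ind : pbw_induction x c vac.
Let M_indE (N : lmodType K) (F H : M -> N) := @M_ind N F H.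
Variables (u : K).
Implicit Types (a b j k : 'I_n) (s t : {linear M -> M}).
Local Notation short := (short_refl x c u).
Local Notation long := (long_refl x c).

Lemma agree_ind (F H : {linear M -> M}) : (forall w, F (vac w) = H (vac w)) ->
  (forall k m, F m = H m -> agree F H (x k) (c k) m) -> F =1 H.
Proof.
move=> FHv FH; apply: M_indE => // [z p q|z p q|k m /(FH k)[] //|k m /(FH k)[] //];
  exact: linearP.
Qed.

Lemma agree_fixes2 s t k m : fixes s (x k) (c k) -> fixes t (x k) (c k) ->
  s (t m) = t (s m) -> agree (s \o t) (t \o s) (x k) (c k) m.
Proof. by move=> [sx sc] [tx tc] e; split; rewrite /= !(sx, tx, sc, tc) e. Qed.

Lemma short1_swaps a b s : short a b 1 s -> swaps u s (x a) (x b) (c a) (c b).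
Proof.
have d1 (d : {linear M -> M}) m : dswap1 u (c a) (1 \*: d) m = dswap1 u (c a) d m.
  by rewrite /dswap1 /= scale1r.
have d2 (d : {linear M -> M}) m : dswap2 u (c a) (1 \*: d) m = dswap2 u (c a) d m.
  by rewrite /dswap2 /= scale1r.
move=> [[sx sy sc sd] _]; split=> m; rewrite ?sx ?sc /= ?scale1r ?d1 //.
  by rewrite -[x b m]scale1r sy d2.
by rewrite -[c b m]scale1r sd.
Qed.

Lemma anticomm_scale a b (eta : K) m : a != b ->
  c a ((eta \*: c b) m) = - (eta \*: c b) (c a m).
Proof. by case: xc => [_ _ _ _ cA] ab; rewrite /= linearZ /= cA // scalerN. Qed.

Lemma short_refl_invol a b eta s : a != b -> eta * eta = 1 -> short a b eta s ->
  (forall w, s (s (vac w)) = vac w) -> forall m, s (s m) = m.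
Proof.
move=> ab ee [sw sf] sv.
apply: (agree_ind (F := s \o s) (H := idfun)) => //= k m e.
have [Aa Ab] := swaps_invol (anticomm_scale _ ^~ ab) sw e.
have [->|ka] := eqVneq k a => //; have [->|kb] := eqVneq k b.
  by apply: agree_scale ee Ab => z p q; rewrite /= ?linearP.
by have [sx sc] := sf k ka kb; split; rewrite /= ?sx ?sc e.
Qed.

Lemma long_refl_invol kappa b s : long kappa b s ->
  (forall w, s (s (vac w)) = vac w) -> forall m, s (s m) = m.
Proof.
move=> [sw sf] sv.
apply: (agree_ind (F := s \o s) (H := idfun)) => //= k m e.
have [->|kb] := eqVneq k b; first exact: negates_invol sw e.
by have [sx sc] := sf k kb; split; rewrite /= ?sx ?sc e.
Qed.

Lemma short_comm a b a' b' eta eta' s t : a != b -> a' != b' ->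
  eta * eta = 1 -> eta' * eta' = 1 ->
  a != a' -> a != b' -> b != a' -> b != b' ->
  short a b eta s -> short a' b' eta' t ->
  (forall w, s (t (vac w)) = t (s (vac w))) -> forall m, s (t m) = t (s m).
Proof.
move=> ab ab' ee ee' aa' ab'' ba' bb' [sw sf] [tw tf] stv.
apply: (agree_ind (F := s \o t) (H := t \o s)) => //= k m e.
have sy : fixes s (eta' \*: x b') (eta' \*: c b').
  by apply/fixes_scale/sf; rewrite eq_sym.
have ty : fixes t (eta \*: x b) (eta \*: c b) by apply/fixes_scale/tf.
have [Aa Ab] := swaps_comm_fixes sw (tf _ aa' ab'') ty e.
have [Aa' Ab'] : agree (s \o t) (t \o s) (x a') (c a') m /\
    agree (s \o t) (t \o s) (eta' \*: x b') (eta' \*: c b') m.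
  have [//||[e1 e2] [e3 e4]] := swaps_comm_fixes tw (sf a' _ _) sy (esym e); rewrite 1?eq_sym //.
have [->|ka] := eqVneq k a => //; have [->|kb] := eqVneq k b.
  by apply: agree_scale ee Ab => z p q; rewrite /= !linearP.
have [->|ka'] := eqVneq k a' => //; have [->|kb'] := eqVneq k b'.
  by apply: agree_scale ee' Ab' => z p q; rewrite /= !linearP.
by apply: agree_fixes2 => //; [apply: sf|apply: tf].
Qed.

Lemma short_comm_opp a b s t : a != b -> short a b 1 s -> short a b (-1) t ->
  (forall w, s (t (vac w)) = t (s (vac w))) -> forall m, s (t m) = t (s m).
Proof.
move=> ab ss [tw tf] stv; have [_ sf] := ss.
have sw := short1_swaps ss.
apply: (agree_ind (F := s \o t) (H := t \o s)) => //= k m e.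
have [|||Aa Ab] := swaps_comm_opp _ _ _ sw tw e.
- by case: xc => [_ _ _ _ cA] m'; rewrite cA.
- by move=> m' /=; rewrite scaleN1r.
- by move=> m' /=; rewrite scaleN1r.
have [->|ka] := eqVneq k a => //; have [->|kb] := eqVneq k b => //.
by apply: agree_fixes2 => //; [apply: sf|apply: tf].
Qed.

Lemma short_long_comm a b b' eta kappa s t : a != b -> eta * eta = 1 ->
  a != b' -> b != b' -> short a b eta s -> long kappa b' t ->
  (forall w, s (t (vac w)) = t (s (vac w))) -> forall m, s (t m) = t (s m).
Proof.
move=> ab ee ab' bb' [sw sf] [tw tf] stv.
apply: (agree_ind (F := s \o t) (H := t \o s)) => //= k m e.
have ty : fixes t (eta \*: x b) (eta \*: c b) by apply/fixes_scale/tf.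
have [Aa Ab] := swaps_comm_fixes sw (tf _ ab') ty e.
have sb' : fixes s (x b') (c b') by apply: sf; rewrite eq_sym.
have [->|ka] := eqVneq k a => //; have [->|kb] := eqVneq k b.
  by apply: agree_scale ee Ab => z p q; rewrite /= !linearP.
have [->|kb'] := eqVneq k b'.
  by have [e1 e2] := negates_comm_fixes tw sb' (esym e).
by apply: agree_fixes2 => //; [apply: sf|apply: tf].
Qed.

(** The sign on t covers both the pairs s_i, s_{i+1} and, with eta = -1, the pair s_{n-2}, s_n of
    type D. *)
Lemma short_braid3 a b d eta s t : a != b -> b != d -> a != d -> eta * eta = 1 ->
  short a b 1 s -> short b d eta t ->
  (forall m, s (s m) = m) -> (forall m, t (t m) = m) ->
  (forall w, s (t (s (vac w))) = t (s (t (vac w)))) ->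
  forall m, s (t (s m)) = t (s (t m)).
Proof.
move=> ab bd ad ee ssh [tw tf] ss tt stv; have [_ sf] := ssh.
have sw := short1_swaps ssh.
apply: (agree_ind (F := s \o t \o s) (H := t \o s \o t)) => //= k m e.
have sd : fixes s (eta \*: x d) (eta \*: c d).
  by apply/fixes_scale/sf; rewrite eq_sym.
have [Aa Ab Ad] := swaps_braid3 sw sd tw (tf _ ab ad) ss tt e.
have [->|ka] := eqVneq k a => //; have [->|kb] := eqVneq k b => //.
have [->|kd] := eqVneq k d.
  by apply: agree_scale ee Ad => z p q; rewrite /= !linearP.
have [sx sc] := sf k ka kb; have [tx tc] := tf k kb kd.
by split; rewrite /= !(sx, sc, tx, tc) e.
Qed.

Lemma short_long_braid4 a b kappa s t : a != b -> short a b 1 s -> long kappa b t ->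
  (forall m, s (s m) = m) -> (forall m, t (t m) = m) ->
  (forall w, s (t (s (t (vac w)))) = t (s (t (s (vac w))))) ->
  forall m, s (t (s (t m))) = t (s (t (s m))).
Proof.
move=> ab ssh [tw tf] ss tt stv; have [_ sf] := ssh.
have sw := short1_swaps ssh.
apply: (agree_ind (F := s \o t \o s \o t) (H := t \o s \o t \o s)) => //= k m e.
have [|Aa Ab] := swaps_braid4 _ sw tw (tf _ ab) ss tt e.
  by case: xc => [_ _ _ _ cA] m'; rewrite cA.
have [->|ka] := eqVneq k a => //; have [->|kb] := eqVneq k b => //.
have [sx sc] := sf k ka kb; have [tx tc] := tf k kb.
by split; rewrite /= !(sx, sc, tx, tc) e.
Qed.

End CoxeterRelations.

(** * Linear maps commuting with the reflections *)

Section Intertwiners.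
Variables (K : comNzRingType) (n : nat) (G : Type) (M N : lmodType K).
Variables (x c : 'I_n -> {linear M -> M}) (vac : G -> M).
Variables (x' c' : 'I_n -> {linear N -> N}).
Hypothesis M_ind : pbw_induction x c vac.
Let M_indE (N : lmodType K) (F H : M -> N) := @M_ind N F H.
Variable F : {linear M -> N}.
Hypothesis Fx : forall j m, F (x j m) = x' j (F m).
Hypothesis Fc : forall j m, F (c j m) = c' j (F m).

(** The rules of [short_refl] determine s from its values at the vectors [vac w], and F carries
    these rules for s to those for s', so agreement at [vac w] suffices. *)
Lemma short_refl_intertwine u a b eta s s' : eta * eta = 1 ->
  short_refl x c u a b eta s -> short_refl x' c' u a b eta s' ->
  (forall w, F (s (vac w)) = s' (F (vac w))) -> forall m, F (s m) = s' (F m).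
Proof.
move=> ee [[sx sy sc sd] sf] [[sx' sy' sc' sd'] sf'] Fv.
have eeK (V : lmodType K) (v : V) : eta *: (eta *: v) = v by rewrite scalerA ee scale1r.
apply: (M_indE (F := F \o s) (H := s' \o F)) => //= [z p q|z p q|j m e|j m e].
- by rewrite !linearP.
- by rewrite !linearP.
- have [->|ja] := eqVneq j a; last have [->|jb] := eqVneq j b.
  + rewrite sx Fx sx' /= linearD linearZ /= Fx e /dswap1.
    by rewrite [F (u *: _)]linearZ linearB /= linearZ /= !Fc.
  (* The rule at b is stated for eta x_b, so x_b is written as eta (eta x_b). *)
  + rewrite Fx -[x b m]eeK -[x' b _]eeK [s _]linearZ [s' _]linearZ.
    rewrite [F _]linearZ /= [s _]sy [s' _]sy' linearD /= Fx e /dswap2.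
    by rewrite [F (u *: _)]linearZ linearD /= linearZ /= !Fc.
  + by rewrite Fx !(sf j _ _).1 // !(sf' j _ _).1 // Fx e.
- have [->|ja] := eqVneq j a; last have [->|jb] := eqVneq j b.
  + by rewrite sc Fc sc' /= linearZ /= Fc e.
  + rewrite Fc -[c b m]eeK -[c' b _]eeK [s _]linearZ [s' _]linearZ.
    by rewrite [F _]linearZ /= [s _]sd [s' _]sd' Fc e.
  + by rewrite Fc !(sf j _ _).2 // !(sf' j _ _).2 // Fc e.
Qed.

Lemma long_refl_intertwine kappa b s s' :
  long_refl x c kappa b s -> long_refl x' c' kappa b s' ->
  (forall w, F (s (vac w)) = s' (F (vac w))) -> forall m, F (s m) = s' (F m).
Proof.
move=> [[sx sc] sf] [[sx' sc'] sf'] Fv.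
apply: (M_indE (F := F \o s) (H := s' \o F)) => //= [z p q|z p q|j m e|j m e].
- by rewrite !linearP.
- by rewrite !linearP.
- have [->|jb] := eqVneq j b.
  + by rewrite sx Fx sx' linearD linearN linearZ /= Fx e.
  + by rewrite Fx !(sf j _).1 // !(sf' j _).1 // Fx e.
- have [->|jb] := eqVneq j b.
  + by rewrite sc Fc sc' linearN Fc e.
  + by rewrite Fc !(sf j _).2 // !(sf' j _).2 // Fc e.
Qed.

End Intertwiners.

(** * Modules over algebras given by generators and relations *)

Section FreeAction.
Variables (K : comNzRingType) (I : choiceType) (N : lmodType K).
Variable op : I -> {linear N -> N}.

Definition free_act (m : N) : freealg K I -> N :=
  linext (fun t : {fmonom I} => foldr (fun i => op i) m (t : seq I)).

Fact free_act_is_linear m : linear (free_act m).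
Proof. exact: linext_is_linear. Qed.
HB.instance Definition _ m :=
  GRing.isLinear.Build K (freealg K I) N *:%R (free_act m) (free_act_is_linear m).

Lemma free_actU m (t : {fmonom I}) :
  free_act m << t >> = foldr (fun i => op i) m (t : seq I).
Proof. exact: linextU. Qed.

Lemma free_act1 m : free_act m 1 = m.
Proof. by rewrite [1]/(<< (mone : {fmonom I}) >> : {malg K[_]}) free_actU fm1. Qed.

Lemma free_act_gen m i : free_act m (fgen K i) = op i m.
Proof. by rewrite free_actU fmU. Qed.

Lemma malgUM (t t' : {fmonom I}) :
  << t >> * << t' >> = << mmul t t' >> :> {malg K[{fmonom I}]}.
Proof. by rewrite malgM_def fgmulUU mulr1. Qed.

Lemma free_act_linear_vec p : linear (free_act ^~ p).
Proof.
move=> z m m'.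
pose F q := free_act (z *: m + m') q.
pose H q := z *: free_act m q + free_act m' q.
apply: (@eq_linear_malg _ _ _ F H _ _ _ p) => [k q q'|k q q'|t].
- exact: linearP.
- by rewrite /H ![free_act _ (_ + _)]linearP /= !scalerDr !scalerA addrACA [z * k]mulrC.
- rewrite /F /H !free_actU; elim: (t : seq I) => //= i s ->.
  by rewrite linearP.
Qed.

Lemma free_actM m p q : free_act m (p * q) = free_act (free_act m q) p.
Proof.
pose F p := free_act m (p * q).
apply: (@eq_linear_malg _ _ _ F (free_act (free_act m q)) _ _ _ p).
- by move=> z r r'; rewrite /F mulrDl -scalerAl linearP.
- exact: linearP.
move=> t; rewrite /F.
pose F' q := free_act m (<< t >> * q).
pose H' q := free_act (free_act m q) << t >>.
apply: (@eq_linear_malg _ _ _ F' H' _ _ _ q).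
- by move=> z r r'; rewrite /F' mulrDr -malg_scalerAr linearP.
- by move=> z r r'; rewrite /H' linearP free_act_linear_vec.
by move=> t'; rewrite /F' /H' malgUM !free_actU fmM foldr_cat.
Qed.

Lemma free_act2 m i j : free_act m (fgen K i * fgen K j) = op i (op j m).
Proof. by rewrite free_actM !free_act_gen. Qed.

Lemma free_act2N m i j : free_act m (- (fgen K i * fgen K j)) = - op i (op j m).
Proof. by rewrite linearN; congr (- _); apply: free_act2. Qed.

Variable rel : freealg K I -> freealg K I -> Prop.
Hypothesis op_rel : forall p q, rel p q -> forall m, free_act m p = free_act m q.

Definition pres_act (m : N) : presalg rel -> N := lquot_lift (free_act m).

(** In [a * p * b] the relation acts on the vector b m, so it must be known at every vector and not
    only at the generating ones. *)
Lemma free_act_ideal m p q : ideal_rel rel p q -> free_act m p = free_act m q.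
Proof.
case=> a {}p {}q b /op_rel pq.
have E r : free_act m (a * r * b) = free_act (free_act (free_act m b) r) a.
  apply: (etrans (free_actM m (a * r) b)).
  exact: (free_actM (free_act m b) a r).
apply: (etrans (E p)).
apply: (etrans _ (esym (E q))).
by rewrite pq.
Qed.

Lemma pres_act_api m p : pres_act m (api rel p) = free_act m p.
Proof. exact: (lquot_liftE (@free_act_ideal m)). Qed.

Lemma pres_act_linear m : linear (pres_act m).
Proof. exact: (lquot_lift_linear (@free_act_ideal m)). Qed.

Lemma pres_act1 m : pres_act m 1 = m.
Proof. by rewrite -api1 pres_act_api free_act1. Qed.

Lemma pres_act_genM m i h :
  pres_act m (pgen rel i * h) = op i (pres_act m h).
Proof.
elim/algquotP: h => p; rewrite /pgen -apiM !pres_act_api free_actM.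
exact: free_act_gen.
Qed.

(** Commuting with the generators implies commuting with words, hence with everything. When
    [F m = 1] this shows that F is a left inverse of the orbit map of m, in the sense F (h m) =
    h. *)
Lemma pres_act_intertwine (F : {linear N -> presalg rel}) m h :
  (forall i m, F (op i m) = pgen rel i * F m) -> F (pres_act m h) = h * F m.
Proof.
move=> Fop; elim/algquotP: h => p; rewrite pres_act_api.
pose F' q := F (free_act m q).
pose H' q := api rel q * F m.
apply: (@eq_linear_malg _ _ _ F' H' _ _ _ p).
- by move=> z r r'; rewrite /F' !linearP.
- by move=> z r r'; rewrite /H' linearP mulrDl -algquot_scalerAl.
move=> t; rewrite /F' /H' free_actU.
case: t => s; elim: s => /= [|i s IH].
  have -> : << FMonom [::] >> = 1 :> freealg K I by rewrite -fmoneE.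
  by rewrite api1 mul1r.
have -> : << FMonom (i :: s) >> = fgen K i * << FMonom s >> :> freealg K I.
  by rewrite [RHS]malgUM; congr << _ >>; apply/eqP; rewrite fmP fmM fmU.
by rewrite apiM -mulrA -IH Fop.
Qed.

End FreeAction.

(** * The reflection rules for left multiplication in a quotient algebra *)

Section LeftMultiplication.
Variables (K : comNzRingType) (A : algType K) (rel : A -> A -> Prop).

Definition lmulop (a : algquot rel) : algquot rel -> algquot rel := fun b => a * b.

Lemma lmulopE a b : lmulop a b = a * b. Proof. by []. Qed.

Fact lmulop_is_linear a : linear (lmulop a).
Proof. by move=> z b b'; rewrite /lmulop mulrDr algquot_scalerAr. Qed.
HB.instance Definition _ a :=
  GRing.isLinear.Build K (algquot rel) (algquot rel) *:%R (lmulop a) (lmulop_is_linear a).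

End LeftMultiplication.

Section LeftMultiplicationRelations.
Variables (K : comNzRingType) (A : algType K) (rel : A -> A -> Prop) (n : nat).
Local Notation B := (algquot rel).
Variables hx hc : 'I_n -> B.
Implicit Types (i j k : 'I_n) (s : B).

Lemma opword_lmulop (y : 'I_n -> B) (a : 'I_n -> nat) r h :
  opword (fun k => lmulop (y k)) a r h = (\prod_(k <- r) y k ^+ a k) * h.
Proof.
elim: r => /= [|k r IH]; first by rewrite big_nil mul1r.
rewrite big_cons IH -mulrA; elim: (a k) => /= [|d ->]; first by rewrite mul1r.
by rewrite lmulopE exprS !mulrA.
Qed.

Hypothesis hxx : forall i j, hx i * hx j = hx j * hx i.
Hypothesis hxc : forall i, hx i * hc i = - (hc i * hx i).
Hypothesis hxc_ne : forall i j, i != j -> hx i * hc j = hc j * hx i.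
Hypothesis hcc : forall i, hc i * hc i = 1.
Hypothesis hc_anti : forall i j, i != j -> hc i * hc j = - (hc j * hc i).

Lemma lmulop_cliffpoly : cliffpoly (fun j => lmulop (hx j)) (fun j => lmulop (hc j)).
Proof.
split=> [j k|j|j k jk|j|j k jk] m; rewrite /= !lmulopE !mulrA.
- by rewrite hxx.
- by rewrite hxc mulNr.
- by rewrite hxc_ne.
- by rewrite hcc mul1r.
- by rewrite hc_anti // mulNr.
Qed.

(** The rules for the index i are given; those for j follow from them by conjugating with the
    involution s. *)
Lemma lmulop_short_refl u i j (eta : K) s : i != j -> eta * eta = 1 -> s * s = 1 ->
  s * hx i = eta *: (hx j * s) + u *: (eta *: (hc j * hc i) - 1) ->
  s * hc i = eta *: (hc j * s) ->
  (forall k, k != i -> k != j -> s * hx k = hx k * s) ->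
  (forall k, k != i -> k != j -> s * hc k = hc k * s) ->
  short_refl (fun k => lmulop (hx k)) (fun k => lmulop (hc k)) u i j eta (lmulop s).
Proof.
move=> ij ee ss sx sc sxk sck.
have scj : eta *: (s * hc j) = hc i * s.
  have -> : eta *: (s * hc j) = s * (eta *: (hc j * s)) * s.
    by rewrite -algquot_scalerAr -algquot_scalerAl -!mulrA ss mulr1.
  by rewrite -sc !mulrA ss mul1r.
have sxj : eta *: (s * hx j) = hx i * s + u *: (1 + eta *: (hc j * hc i)).
  have -> : eta *: (s * hx j) = s * (eta *: (hx j * s)) * s.
    by rewrite -algquot_scalerAr -algquot_scalerAl -!mulrA ss mulr1.
  have -> : eta *: (hx j * s) = s * hx i - u *: (eta *: (hc j * hc i) - 1).
    by rewrite sx addrK.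
  (* Conjugation exchanges eta c_j and c_i, which anticommute; the constant 1 keeps its sign, and
     this turns the first kind of correction into the second. *)
  have E : s * (eta *: (hc j * hc i)) * s = - (eta *: (hc j * hc i)).
    rewrite -algquot_scalerAr -algquot_scalerAl.
    have -> : s * (hc j * hc i) * s = (s * hc j) * (hc i * s) by rewrite !mulrA.
    rewrite algquot_scalerAl scj -mulrA (mulrA s) sc -algquot_scalerAl.
    by rewrite -algquot_scalerAr -mulrA ss mulr1 hc_anti // scalerN.
  rewrite mulrBr mulrBl mulrA ss mul1r -algquot_scalerAr -algquot_scalerAl.
  by rewrite mulrBr mulrBl mulr1 ss E -scalerN opprB opprK.
split=> [|k ki kj]; last by split=> m; rewrite /= !lmulopE !mulrA ?sxk ?sck.
have zM (z : K) (a b : B) : (z *: a) * b = z *: (a * b) by rewrite algquot_scalerAl.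
have Mz (z : K) (a b : B) : a * (z *: b) = z *: (a * b) by rewrite algquot_scalerAr.
split=> m; rewrite /dswap1 /dswap2 /= !lmulopE ?Mz !mulrA.
- by rewrite sx mulrDl !zM mulrBl zM mul1r.
- by rewrite -zM sxj mulrDl !zM mulrDl zM mul1r.
- by rewrite sc zM.
- by rewrite -zM scj.
Qed.

Lemma lmulop_long_refl kappa i s :
  s * hx i = - (hx i * s) + kappa *: (1 : B) -> s * hc i = - (hc i * s) ->
  (forall k, k != i -> s * hx k = hx k * s) ->
  (forall k, k != i -> s * hc k = hc k * s) ->
  long_refl (fun k => lmulop (hx k)) (fun k => lmulop (hc k)) kappa i (lmulop s).
Proof.
move=> sx sc sxk sck; split=> [|k ki].
  split=> m; rewrite /= !lmulopE !mulrA.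
    by rewrite sx mulrDl mulNr -algquot_scalerAl mul1r.
  by rewrite sc mulNr.
by split=> m; rewrite /= !lmulopE !mulrA ?sxk ?sck.
Qed.

End LeftMultiplicationRelations.

(** * The Hecke-Clifford algebras *)

Section SymmetricRefl.
Variables (K : comNzRingType) (n : nat) (N : lmodType K).
Variables (x c : 'I_n -> {linear N -> N}).

(** Exchanging x_a with -x_b is the same as exchanging x_b with -x_a. This reconciles two orders of
    the pair: the relations of s_n in type D give the rule starting from x_n, while the operator on
    M is built starting from x_{n-1}. *)
Lemma short_refl_opp_sym (u : K) (a b : 'I_n) (s : {linear N -> N}) :
  cliffpoly x c -> a != b ->
  short_refl x c u a b (-1) s -> short_refl x c u b a (-1) s.
Proof.
move=> [_ _ _ _ cA] ab [[sx sy sc sd] sf].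
split=> [|k kb ka]; last exact: sf.
have D1 m : dswap1 u (c b) (-1 \*: c a) m = - dswap2 u (c a) (-1 \*: c b) m.
  by rewrite /dswap1 /dswap2 /= !scaleN1r -scalerN opprB cA // opprK.
have D2 m : dswap2 u (c b) (-1 \*: c a) m = - dswap1 u (c a) (-1 \*: c b) m.
  by rewrite /dswap1 /dswap2 /= !scaleN1r -scalerN opprD !opprK cA // opprK addrC.
split=> m.
- by apply: oppr_inj; rewrite D1 /= scaleN1r opprD !opprK -linearN -scaleN1r; apply: sy.
- by rewrite D2 /= !scaleN1r linearN sx /= scaleN1r opprD opprK.
- by apply: oppr_inj; rewrite /= scaleN1r opprK -linearN -scaleN1r; apply: sd.
- by rewrite /= !scaleN1r linearN sc /= scaleN1r opprK.
Qed.

End SymmetricRefl.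

Section HeckeCliffordRelations.
Variables (K : numClosedFieldType) (n : nat) (u : K).
Variables (W : seq 'I_n -> seq 'I_n -> Prop).
Variable special : freealg K (hgen n) -> freealg K (hgen n) -> Prop.
Implicit Types i j l : 'I_n.
Local Notation H := (hcalg u W special).
Local Notation hx := (hx u W special).
Local Notation hc := (hc u W special).
Local Notation hs := (hs u W special).
Local Notation hrel := (hc_rel u W special).

Lemma hx_hc i : hx i * hc i = - (hc i * hx i).
Proof. by rewrite -!apiM -linearN; apply/algquot_rel/hc_xc. Qed.

Lemma hx_hc_ne i j : i != j -> hx i * hc j = hc j * hx i.
Proof. by move=> ij; rewrite -!apiM; apply/algquot_rel/hc_xc_ne. Qed.

Lemma hc_sq i : hc i * hc i = 1.
Proof. by rewrite -apiM; apply/algquot_rel/hc_cliff/clifford_sq. Qed.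

Lemma hc_anti i j : i != j -> hc i * hc j = - (hc j * hc i).
Proof.
by move=> ij; rewrite -!apiM -linearN; apply/algquot_rel/hc_cliff/clifford_anti.
Qed.

Lemma hx_hc_cliffpoly : cliffpoly (fun j => lmulop (hx j)) (fun j => lmulop (hc j)).
Proof.
exact: (lmulop_cliffpoly (hx_comm u W special) hx_hc hx_hc_ne hc_sq hc_anti).
Qed.

Lemma hs_invol i : hs i * hs i = 1.
Proof. by rewrite -!apiM; apply/algquot_rel/hc_invol. Qed.

Lemma adj_tpermE i j : j = i.+1 :> nat -> adj_tperm i =1 tperm i j.
Proof.
move=> ij k; rewrite /adj_tperm; case: insubP => [j' _ j'E|].
  by congr (tperm i _ k); apply: val_inj; rewrite /= ij -j'E.
by rewrite -ij ltn_ord.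
Qed.

Lemma hs_hc i j k : j = i.+1 :> nat -> hs i * hc k = hc (tperm i j k) * hs i.
Proof.
move=> ij; have wi : all (fun k : 'I_n => (k.+1 < n)%N) [:: i].
  by rewrite /= -ij ltn_ord.
have := algquot_rel (hc_sc u W special k wi).
have -> : fsword K [:: i] = fs K i by rewrite /fsword big_seq1.
rewrite /word_act /= (adj_tpermE ij) => e.
exact: etrans (esym (apiM _ _ _)) (etrans e (apiM _ _ _)).
Qed.

Lemma hs_hx i j : j = i.+1 :> nat ->
  hs i * hx i = hx j * hs i + u *: (hc j * hc i - 1).
Proof.
move=> ij; have e : hx j * hs i - hs i * hx i = u *: (1 - hc j * hc i).
  rewrite -!apiM -[1]/(api hrel 1) -!linearB -linearZ.
  exact: (algquot_rel (hc_xs u W special ij)).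
by rewrite -[_ - 1]opprB scalerN -e opprB addrC subrK.
Qed.

Lemma hs_short_refl i j : j = i.+1 :> nat ->
  short_refl (fun k => lmulop (hx k)) (fun k => lmulop (hc k)) u i j 1 (lmulop (hs i)).
Proof.
move=> ij; have iNj : i != j by rewrite -val_eqE /= ij neq_ltn ltnSn.
apply: (lmulop_short_refl hc_anti iNj (mulr1 1) (hs_invol i)); rewrite ?scale1r.
- exact: hs_hx.
- by rewrite (hs_hc _ ij) tpermL.
- move=> k ki kj; rewrite -!apiM; apply/esym/algquot_rel/hc_xs_ne.
  + by rewrite -ij ltn_ord.
  + by move/val_inj/eqP; rewrite (negPf ki).
  + by rewrite -ij => /val_inj/eqP; rewrite (negPf kj).
- by move=> k ki kj; rewrite (hs_hc _ ij) tpermD // eq_sym.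
Qed.

Lemma hmon_hcliff_opword (a : 'X_{1..n}) (e : {ffun 'I_n -> bool}) (h : H) :
  opword (fun k => lmulop (hx k)) a (index_enum _)
    (opword (fun k => lmulop (hc k)) (fun i => e i) (index_enum _) h) =
  hmon u W special a * hcliff u W special e * h.
Proof. by rewrite !opword_lmulop mulrA. Qed.

Section Action.
Variable M : lmodType K.
Variables (x c S : 'I_n -> {linear M -> M}).
Hypothesis xc : cliffpoly x c.

Definition hop (g : hgen n) : {linear M -> M} :=
  match g with inl (inl i) => x i | inl (inr i) => c i | inr i => S i end.

Lemma hact_eq2 m g h g' h' : hop g (hop h m) = hop g' (hop h' m) ->
  free_act hop m (fgen K g * fgen K h) = free_act hop m (fgen K g' * fgen K h').
Proof. by move=> e; rewrite [LHS]free_act2 [RHS]free_act2. Qed.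

Lemma hact_eq2N m g h g' h' : hop g (hop h m) = - hop g' (hop h' m) ->
  free_act hop m (fgen K g * fgen K h) = free_act hop m (- (fgen K g' * fgen K h')).
Proof. by move=> e; rewrite [LHS]free_act2 [RHS]free_act2N. Qed.

Lemma hact_eq1 m g h : hop g (hop h m) = m ->
  free_act hop m (fgen K g * fgen K h) = free_act hop m 1.
Proof. by move=> e; rewrite [LHS]free_act2 [RHS]free_act1. Qed.

Lemma hact_word m w : free_act hop m (fsword K w) = foldr (fun i => S i) m w.
Proof.
rewrite /fsword; elim: w => /= [|i w IH]; first by rewrite big_nil free_act1.
by rewrite big_cons [LHS]free_actM IH; apply: free_act_gen.
Qed.

Lemma hact_rel :
  (forall i m, S i (S i m) = m) ->
  (forall i j, j = i.+1 :> nat -> short_refl x c u i j 1 (S i)) ->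
  (forall v w, W v w -> forall m, foldr (fun i => S i) m v = foldr (fun i => S i) m w) ->
  (forall p q, special p q -> forall m, free_act hop m p = free_act hop m q) ->
  forall p q, hrel p q -> forall m, free_act hop m p = free_act hop m q.
Proof.
have [xx xc1 xcn cc cA] := xc.
move=> SS Ssh SW Ssp _ _ [i|v w vw|p q [i|i j ij]|i j|i|i j ij|w i wn|i j ij|i j ni ji jsi|p q pq] m.
- exact: (hact_eq1 (g := inr i) (h := inr i) (SS i m)).
- by rewrite !hact_word; apply: SW.
- exact: (hact_eq1 (g := inl (inr i)) (h := inl (inr i)) (cc i m)).
- exact: (hact_eq2N (g := inl (inr i)) (h := inl (inr j))
           (g' := inl (inr j)) (h' := inl (inr i)) (cA _ _ ij m)).
- exact: (hact_eq2 (g := inl (inl i)) (h := inl (inl j))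
           (g' := inl (inl j)) (h' := inl (inl i)) (xx i j m)).
- exact: (hact_eq2N (g := inl (inl i)) (h := inl (inr i))
           (g' := inl (inr i)) (h' := inl (inl i)) (xc1 i m)).
- exact: (hact_eq2 (g := inl (inl i)) (h := inl (inr j))
           (g' := inl (inr j)) (h' := inl (inl i)) (xcn _ _ ij m)).
- rewrite [LHS]free_actM [RHS]free_actM !hact_word.
  have hact_c m' k : free_act hop m' (fc K k) = c k m' by apply: free_act_gen.
  (* Each letter k of the word satisfies k + 1 < n, so it passes c by the transposition of k and k +
     1. *)
  rewrite !hact_c; elim: w wn => //= k w IH /andP[kn /IH->].
  have [j kj] : exists j : 'I_n, j = k.+1 :> nat by exists (Ordinal kn).
  have [_ sf] := Ssh k j kj; have [_ _ sc sd] := short1_swaps (Ssh k j kj).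
  rewrite (adj_tpermE kj); set h := word_act w i.
  have [->|hk] := eqVneq h k; first by rewrite tpermL sc.
  have [->|hj] := eqVneq h j; first by rewrite tpermR sd.
  by rewrite tpermD 1?eq_sym // (sf h hk hj).2.
- have [sx _ _ _] := short1_swaps (Ssh i j ij).
  have E1 := free_act2 hop m (inl (inl j)) (inr i); have E2 := free_act2 hop m (inr i) (inl (inl i)).
  have E3 := free_act2 hop m (inl (inr j)) (inl (inr i)).
  rewrite linearB linearZ linearB /= [X in X - _]E1 [X in _ - X]E2 /=.
  rewrite [X in _ *: (_ - X)]E3 /= free_act1 sx /dswap1.
  by rewrite opprD addrA subrr add0r -scalerN opprB.
- have [_ sf] := Ssh i (Ordinal ni) erefl.
  have ij1 : j != i by apply/eqP => /(congr1 val).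
  have ij2 : j != Ordinal ni by apply/eqP => /(congr1 val).
  exact: (hact_eq2 (g := inl (inl j)) (h := inr i)
           (g' := inr i) (h' := inl (inl j)) (esym ((sf j ij1 ij2).1 m))).
- exact: Ssp.
Qed.

End Action.
End HeckeCliffordRelations.

Section Special.
Variables (K : numClosedFieldType) (n : nat) (u v : K).
Implicit Types i l : 'I_n.

Lemma hsD_short_refl i l : l.+1 = n -> i.+2 = n ->
    let hx' := hx u (weylD_rel n) (hcD_special n u) in
  let hc' := hc u (weylD_rel n) (hcD_special n u) in
  let hs' := hs u (weylD_rel n) (hcD_special n u) in
  short_refl (fun k => lmulop (hx' k)) (fun k => lmulop (hc' k)) u l i (-1) (lmulop (hs' l)).
Proof.
move=> ln i_n hx' hc' hs'.
have iNl : l != i.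
  apply/eqP => il; have /eqP := etrans i_n (esym ln).
  by rewrite il eqSS gtn_eqF.
have N1 : -1 * -1 = 1 :> K by rewrite mulrNN mulr1.
have kn k : k != l -> k.+1 <> n.
  by move=> /eqP kl kn; apply/kl/val_inj/succn_inj; rewrite ln kn.
have kn' k : k != i -> k.+2 <> n.
  by move=> /eqP ki kn2; apply/ki/val_inj/succn_inj/succn_inj; rewrite i_n kn2.
apply: (lmulop_short_refl (@hc_anti _ _ _ _ _) iNl N1 (hs_invol _ _ _ _)); rewrite ?scaleN1r.
- have e : hs' l * hx' l + hx' i * hs' l = - u *: (1 + hc' i * hc' l).
    rewrite -!apiM -[1]/(api _ 1) -!linearD -linearZ.
    exact: (algquot_rel (hc_special u (weylD_rel n) (hcD_x u ln i_n))).
  by rewrite -opprD -[u *: _]opprK -scalerN opprK [_ + 1]addrC -scaleNr -e addrC addrK.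
- rewrite -!apiM -linearN.
  exact: (algquot_rel (hc_special u (weylD_rel n) (hcD_c u ln i_n))).
- move=> k kl ki; rewrite -!apiM.
  exact/algquot_rel/hc_special/(hcD_x_ne u ln (kn _ kl) (kn' _ ki)).
- move=> k kl ki; rewrite -!apiM.
  exact/algquot_rel/hc_special/(hcD_c_ne u ln (kn _ kl) (kn' _ ki)).
Qed.

Lemma hsB_long_refl l : l.+1 = n ->
    let hx' := hx u (weylB_rel n) (hcB_special n v) in
  let hc' := hc u (weylB_rel n) (hcB_special n v) in
  let hs' := hs u (weylB_rel n) (hcB_special n v) in
  long_refl (fun k => lmulop (hx' k)) (fun k => lmulop (hc' k)) (- (sqrtC 2 * v)) l (lmulop (hs' l)).
Proof.
move=> ln hx' hc' hs'.
have kn k : k != l -> k.+1 <> n.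
  by move=> /eqP kl kn; apply/kl/val_inj/succn_inj; rewrite ln kn.
apply: lmulop_long_refl.
- have e : hs' l * hx' l + hx' l * hs' l =
      - ((sqrtC 2 * v) *: (1 : hcalg u (weylB_rel n) (hcB_special n v))).
    rewrite -!apiM -linearD.
    apply: (etrans (algquot_rel (hc_special u (weylB_rel n) (hcB_x v ln)))).
    by rewrite linearN linearZ.
  by rewrite scaleNr -e [RHS]addrC addrK.
- rewrite -!apiM -linearN.
  exact: (algquot_rel (hc_special u (weylB_rel n) (hcB_c v ln))).
- move=> k kl; rewrite -!apiM.
  exact/algquot_rel/hc_special/(hcB_x_ne v ln (kn _ kl)).
- move=> k kl; rewrite -!apiM.
  exact/algquot_rel/hc_special/(hcB_c_ne v ln (kn _ kl)).
Qed.

End Special.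

(** * Comparison of M with H *)

Section PBW.
Variables (K : numClosedFieldType) (n : nat) (u : K).
Variables (W : seq 'I_n -> seq 'I_n -> Prop).
Variable special : freealg K (hgen n) -> freealg K (hgen n) -> Prop.
Implicit Types i j l : 'I_n.
Local Notation H := (hcalg u W special).
Local Notation hx := (hx u W special).
Local Notation hc := (hc u W special).
Local Notation hs := (hs u W special).
Local Notation hrel := (hc_rel u W special).
Local Notation hweyl := (hweyl u special).
Local Notation G := (invgroup W).

Variables (M : lmodType K) (b : 'X_{1..n} -> {ffun 'I_n -> bool} -> G -> M).
Variables x c : 'I_n -> {linear M -> M}.
Variable vac : G -> M.
Hypothesis xc : cliffpoly x c.
Hypothesis M_ind : pbw_induction x c vac.
Let M_indE (N : lmodType K) (F H : M -> N) := @M_ind N F H.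
Hypothesis M_lift : pbw_extension x c vac.
Let M_liftE (N : lmodType K) (x' c' : 'I_n -> {linear N -> N}) v :=
  @M_lift N x' c' v.
Hypothesis bE : forall (a : 'X_{1..n}) (e : {ffun 'I_n -> bool}) w,
  opword x a (index_enum _) (opword c (fun i => e i) (index_enum _) (vac w)) = b a e w.

Variable S : 'I_n -> {linear M -> M}.
Hypothesis Sv : forall i w, S i (vac w) = vac (wpi W [:: i] * w)%g.

Lemma S_word v w : foldr (fun i => S i) (vac w) v = vac (wpi W v * w)%g.
Proof.
elim: v => /= [|i v ->]; first by rewrite mul1g.
by rewrite Sv mulgA; congr (vac (_ * _)%g); rewrite [LHS]wpi_cat.
Qed.

Lemma S_wcong v v' w : wcong W v v' ->
  foldr (fun i => S i) (vac w) v = foldr (fun i => S i) (vac w) v'.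
Proof. by move=> /wpi_eq e; rewrite !S_word e. Qed.

Lemma S_vac_invol i w : S i (S i (vac w)) = vac w.
Proof. exact: (S_wcong w (wcong_invol W i)). Qed.

(** The second hypothesis quantifies over F because F is obtained inside the proof, from [M_lift]
    applied to left multiplication on H. The inverse is the orbit map of [vac 1]. *)
Lemma pbw_bijection :
  (forall p q, hrel p q -> forall m, free_act (hop x c S) m p = free_act (hop x c S) m q) ->
  (forall F : {linear M -> H}, (forall j m, F (x j m) = lmulop (hx j) (F m)) ->
     (forall j m, F (c j m) = lmulop (hc j) (F m)) ->
     (forall w, F (vac w) = hweyl w) ->
     forall i m, F (S i m) = lmulop (hs i) (F m)) ->
  exists F : {linear M -> H},
    (forall a e w, F (b a e w) = hmon u W special a * hcliff u W special e * hweyl w)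
    /\ bijective F.
Proof.
move=> Srel Sint.
have [F [Fv Fx Fc]] := M_liftE hweyl (hx_hc_cliffpoly u W special).
have Fs := Sint F Fx Fc Fv.
exists F; split=> [a e w|].
  by rewrite -bE (opword_morph _ _ _ Fx) (opword_morph _ _ _ Fc) Fv hmon_hcliff_opword.
pose v0 := vac 1%g.
pose P := pres_act (rel := hrel) (hop x c S) v0.
have Pl : linear P := pres_act_linear Srel v0.
have PM g h : P (pgen hrel g * h) = hop x c S g (P h) := pres_act_genM Srel v0 g h.
have Fv0 : F v0 = 1 by rewrite /v0 Fv hweyl1.
exists P => [m|h]; last first.
  rewrite /P (pres_act_intertwine Srel) ?Fv0 ?mulr1 // => -[[i|i]|i] m'.
  - exact: Fx.
  - exact: Fc.
  - exact: Fs.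
apply: (M_indE (F := P \o F) (H := id)) m => //.
- by move=> z p q; rewrite /= linearP Pl.
(* Write w as a word: its letters act on [vac 1] one after the other and build up [vac w]. *)
- move=> w; rewrite /= Fv; elim/invgroupP: w => w; rewrite hweylE.
  elim: w => [|i w IH].
    by rewrite big_nil /P (pres_act1 Srel).
  rewrite big_cons [LHS](PM (inr i)) IH /= Sv; congr vac; exact: wpi_cat.
- by move=> j m e; rewrite /= Fx [LHS](PM (inl (inl j))) [P _]e.
- by move=> j m e; rewrite /= Fc [LHS](PM (inl (inr j))) [P _]e.
Qed.

End PBW.

(** * The group relations and the relations of s_n in types D and B *)

Section Types.
Variables (K : numClosedFieldType) (n : nat) (u : K).
Implicit Types i j k l : 'I_n.

Lemma ord_succ i : (i.+1 < n)%N -> exists j, j = i.+1 :> nat.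
Proof. by move=> ni; exists (Ordinal ni). Qed.

Lemma ord_neq i j : (i < j)%N -> i != j.
Proof. by move=> ij; rewrite -val_eqE neq_ltn ij. Qed.

Section SymmetricGroup.
Variables (G : Type) (M : lmodType K).
Variables x c : 'I_n -> {linear M -> M}.
Variable vac : G -> M.
Hypothesis xc : cliffpoly x c.
Hypothesis M_ind : pbw_induction x c vac.
Variable S : 'I_n -> {linear M -> M}.
Hypothesis Sinv : forall i m, S i (S i m) = m.
Hypothesis Ssh : forall i j, j = i.+1 :> nat -> short_refl x c u i j 1 (S i).

Lemma symm_rel_act v w : symm_rel v w ->
  (forall g, foldr (fun i => S i) (vac g) v = foldr (fun i => S i) (vac g) w) ->
  forall m, foldr (fun i => S i) m v = foldr (fun i => S i) m w.
Proof.
case=> [i j ij jn|i j ij jn] /= vacE.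
  (* The bound j + 1 < n in [symm_rel] supplies the third index of the chain. *)
  have [k jk] := ord_succ jn.
  apply: (short_braid3 M_ind _ _ _ (mulr1 1) (Ssh ij) (Ssh jk)) => //;
    apply: ord_neq; lia.
have [k jk] := ord_succ jn.
have [h ih] : exists h : 'I_n, h = i.+1 :> nat.
  by apply: ord_succ; lia.
apply: (short_comm M_ind _ _ (mulr1 1) (mulr1 1) _ _ _ _ (Ssh ih) (Ssh jk)) => //;
  apply: ord_neq; lia.
Qed.

End SymmetricGroup.

Section TypeD.
Hypothesis n4 : (4 <= n)%N.
Local Notation W := (weylD_rel n).
Local Notation special := (hcD_special n u).
Local Notation G := (invgroup W).
Variables (M : lmodType K) (b : 'X_{1..n} -> {ffun 'I_n -> bool} -> G -> M).
Variables x c : 'I_n -> {linear M -> M}.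
Variable vac : G -> M.
Hypothesis xc : cliffpoly x c.
Hypothesis M_ind : pbw_induction x c vac.
Hypothesis M_lift : pbw_extension x c vac.
Hypothesis bE : forall (a : 'X_{1..n}) (e : {ffun 'I_n -> bool}) w,
  opword x a (index_enum _) (opword c (fun i => e i) (index_enum _) (vac w)) = b a e w.

Lemma typeD_bijection : exists F : {linear M -> hcalg u W special},
  (forall a e w, F (b a e w) =
     hmon u W special a * hcliff u W special e * hweyl u special w) /\ bijective F.
Proof.
have N1 : -1 * -1 = 1 :> K by rewrite mulrNN mulr1.
have exS i : exists s : {linear M -> M},
    [/\ forall w, s (vac w) = vac (wpi W [:: i] * w)%g,
        forall j, j = i.+1 :> nat -> short_refl x c u i j 1 s
      & forall k, i.+1 = n -> k.+2 = n -> short_refl x c u k i (-1) s].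
  pose tau w := (wpi W [:: i] * w)%g.
  have [/ord_succ[j ij]|ni] := ltnP i.+1 n.
    have [|s [sv ss]] := short_refl_ex xc M_ind M_lift u (a := i) (b := j) tau _ (mulr1 1).
      by apply: ord_neq; rewrite ij.
    exists s; split=> // [j' ij'|k kn]; first by have -> : j' = j by apply: val_inj; rewrite /= ij ij'.
    by move: (ltn_ord j); rewrite ij kn ltnn.
  (* The last generator is a signed swap of the last two indices, n - 2 and n - 1 when counted from
     0. *)
  have k_n : (n - 2 < n)%N by rewrite ltn_subrL (leq_trans _ n4).
  have kE : (Ordinal k_n).+2 = n by rewrite /= -addn2 subnK // (leq_trans _ n4).
  have iE : i.+1 = n by apply/eqP; rewrite eqn_leq ni ltn_ord.
  have [|s [sv ss]] := short_refl_ex xc M_ind M_lift u (a := Ordinal k_n) (b := i) tau _ N1.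
    by apply: ord_neq; rewrite -ltnS -ltnS kE iE.
  exists s; split=> // [j' ij'|k _ kn]; first by move: (ltn_ord j'); rewrite ij' iE ltnn.
  by have -> : k = Ordinal k_n by apply/val_inj/succn_inj/succn_inj; rewrite kn kE.
have [S SP] := choice exS.
have Sv i := let: And3 e _ _ := SP i in e.
have Ssh i := let: And3 _ e _ := SP i in e.
have Sop i := let: And3 _ _ e := SP i in e.
have last_or i : (exists j, j = i.+1 :> nat) \/ i.+1 = n /\ exists2 k : 'I_n, k.+2 = n & k != i.
  have [/ord_succ ij|ni] := ltnP i.+1 n; first by left.
  right; have k_n : (n - 2 < n)%N by rewrite ltn_subrL (leq_trans _ n4).
  have kE : (Ordinal k_n).+2 = n by rewrite /= -addn2 subnK // (leq_trans _ n4).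
  have iE : i.+1 = n by apply/eqP; rewrite eqn_leq ni ltn_ord.
  by split=> //; exists (Ordinal k_n) => //; apply: ord_neq; rewrite -ltnS -ltnS kE iE.
have Sinv i m : S i (S i m) = m.
  have [[j ij]|[iE [k kE ki]]] := last_or i.
    apply: (short_refl_invol xc M_ind _ (mulr1 1) (Ssh i j ij)) m.
      by apply: ord_neq; rewrite ij.
    by move=> w; apply: S_vac_invol.
  apply: (short_refl_invol xc M_ind ki N1 (Sop i k iE kE)) m.
  by move=> w; apply: S_vac_invol.
apply: (pbw_bijection M_ind M_lift bE Sv).
  apply: hact_rel => // [v w vw|p q pq m].
    have vacE g : foldr (fun i => S i) (vac g) v = foldr (fun i => S i) (vac g) w.
      exact: (S_wcong Sv g (wcong_rel vw)).
    case: vw vacE => {v w} [v w vw|i l ln i3|i l ln i3] /= vacE.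
    - exact: (symm_rel_act M_ind Sinv Ssh vw vacE).
    (* [weylD_comm] comprises three cases: i = l, which is trivial; i the generator s_{n-1}, acting
       on the same pair of indices as s_n; and generators with disjoint pairs. *)
    - have [[j ij]|[iE _]] := last_or i; last first.
        by have -> : i = l by apply/val_inj/succn_inj; rewrite iE ln.
      have [jl|jl] := eqVneq j l.
        subst j; have i2 : i.+2 = n by lia.
        apply: (short_comm_opp xc M_ind _ (Ssh i l ij) (Sop l i ln i2)) => //.
        by apply: ord_neq; rewrite ij.
      have [[j' lj']|[_ [k kE kl]]] := last_or l.
        by move: (ltn_ord j'); rewrite lj' ln ltnn.
      have jl' : j.+1 <> n by move=> jn; move/eqP: jl; apply; apply/val_inj/succn_inj; rewrite ln.
      have jn := ltn_ord j.
      apply: (short_comm M_ind _ kl (mulr1 1) N1 _ _ _ _ (Ssh i j ij) (Sop l k ln kE)) => //;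
        apply: ord_neq; lia.
    - have jn : (i.+1 < n)%N by lia.
      have [j ij] := ord_succ jn; have j2 : j.+2 = n by lia.
      apply: (short_braid3 M_ind _ _ _ N1 (Ssh i j ij) (Sop l j ln j2)) => //;
        apply: ord_neq; lia.
  have act2 := @free_act2 K _ M (hop x c S) m.
  have fixed i l : l.+1 = n -> i.+1 <> n -> i.+2 <> n -> fixes (S l) (x i) (c i).
    move=> ln i1 i2; have [[j lj]|[_ [k kE kl]]] := last_or l.
      by move: (ltn_ord j); rewrite lj ln ltnn.
    have [_ sf] := Sop l k ln kE; apply: sf.
      by apply/eqP => ik; apply: i2; rewrite ik.
    by apply/eqP => il; apply: i1; rewrite il.
  have lNi i l : l.+1 = n -> i.+2 = n -> i != l by move=> ln i2; apply: ord_neq; lia.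
  case: pq => [i l ln i2|i l ln i1 i2|i l ln i2|i l ln i1 i2].
  - have [[_ _ sc _] _] := short_refl_opp_sym xc (lNi i l ln i2) (Sop l i ln i2).
    apply: (hact_eq2N (g := inr l) (h := inl (inr l)) (g' := inl (inr i)) (h' := inr l)).
    by rewrite /= sc /= scaleN1r.
  - have [sx sc] := fixed i l ln i1 i2.
    exact: (hact_eq2 (g := inr l) (h := inl (inr i)) (g' := inl (inr i)) (h' := inr l)).
  - have [[sx _ _ _] _] := short_refl_opp_sym xc (lNi i l ln i2) (Sop l i ln i2).
    rewrite linearD linearZ linearD /=.
    rewrite [X in X + _](act2 (inr l) (inl (inl l))).
    rewrite [X in _ + X = _](act2 (inl (inl i)) (inr l)).
    rewrite [X in _ *: (_ + X)](act2 (inl (inr i)) (inl (inr l))) free_act1 /= sx.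
    rewrite /dswap1 /= !scaleN1r addrC addrA subrr add0r scaleNr -scalerN opprD.
    by congr (_ *: _); rewrite addrC.
  - have [sx sc] := fixed i l ln i1 i2.
    exact: (hact_eq2 (g := inr l) (h := inl (inl i)) (g' := inl (inl i)) (h' := inr l)).
move=> F Fx Fc Fv i m.
have Fs w : F (S i (vac w)) = lmulop (hs u W special i) (F (vac w)).
  by rewrite Sv !Fv hweylM hweylE big_seq1.
have inter := @short_refl_intertwine K n _ M _ x c vac
  (fun k => lmulop (hx u W special k)) (fun k => lmulop (hc u W special k)) M_ind F Fx Fc u.
have [[j ij]|[iE [k kE ki]]] := last_or i.
  exact: (inter _ _ _ _ _ (mulr1 1) (Ssh i j ij) (hs_short_refl _ _ _ ij) Fs).
apply: (inter _ _ _ _ _ N1 (Sop i k iE kE) _ Fs).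
apply: (short_refl_opp_sym (hx_hc_cliffpoly _ _ _)); first by rewrite eq_sym.
exact: hsD_short_refl.
Qed.

End TypeD.

Section TypeB.
Variable v : K.
Local Notation W := (weylB_rel n).
Local Notation special := (hcB_special n v).
Local Notation G := (invgroup W).
Variables (M : lmodType K) (b : 'X_{1..n} -> {ffun 'I_n -> bool} -> G -> M).
Variables x c : 'I_n -> {linear M -> M}.
Variable vac : G -> M.
Hypothesis xc : cliffpoly x c.
Hypothesis M_ind : pbw_induction x c vac.
Hypothesis M_lift : pbw_extension x c vac.
Hypothesis bE : forall (a : 'X_{1..n}) (e : {ffun 'I_n -> bool}) w,
  opword x a (index_enum _) (opword c (fun i => e i) (index_enum _) (vac w)) = b a e w.

Lemma typeB_bijection : exists F : {linear M -> hcalg u W special},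
  (forall a e w, F (b a e w) =
     hmon u W special a * hcliff u W special e * hweyl u special w) /\ bijective F.
Proof.
pose k : K := - (sqrtC 2 * v).
have exS i : exists s : {linear M -> M},
    [/\ forall w, s (vac w) = vac (wpi W [:: i] * w)%g,
        forall j, j = i.+1 :> nat -> short_refl x c u i j 1 s
      & i.+1 = n -> long_refl x c k i s].
  pose tau w := (wpi W [:: i] * w)%g.
  have [/ord_succ[j ij]|ni] := ltnP i.+1 n.
    have [|s [sv ss]] := short_refl_ex xc M_ind M_lift u (a := i) (b := j) tau _ (mulr1 1).
      by apply: ord_neq; rewrite ij.
    exists s; split=> // [j' ij'|iE]; last by move: (ltn_ord j); rewrite ij iE ltnn.
    by have -> : j' = j by apply: val_inj; rewrite /= ij ij'.
  have [s [sv ss]] := long_refl_ex xc M_ind M_lift k i tau.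
  exists s; split=> // j' ij'; move: (ltn_ord j'); lia.
have [S SP] := choice exS.
have Sv i := let: And3 e _ _ := SP i in e.
have Ssh i := let: And3 _ e _ := SP i in e.
have Slo i := let: And3 _ _ e := SP i in e.
have last_or i : (exists j, j = i.+1 :> nat) \/ i.+1 = n.
  have [/ord_succ ij|ni] := ltnP i.+1 n; [by left|right].
  by apply/eqP; rewrite eqn_leq ni ltn_ord.
have Sinv i m : S i (S i m) = m.
  have [[j ij]|iE] := last_or i.
    apply: (short_refl_invol xc M_ind _ (mulr1 1) (Ssh i j ij)) m.
      by apply: ord_neq; rewrite ij.
    by move=> w; apply: S_vac_invol.
  apply: (long_refl_invol M_ind (Slo i iE)) m.
  by move=> w; apply: S_vac_invol.
apply: (pbw_bijection M_ind M_lift bE Sv).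
  apply: hact_rel => // [w w' ww|p q pq m].
    have vacE g : foldr (fun i => S i) (vac g) w = foldr (fun i => S i) (vac g) w'.
      exact: (S_wcong Sv g (wcong_rel ww)).
    case: ww vacE => {w w'} [w w' ww|i l ln i3|i l ln i2] /= vacE.
    - exact: (symm_rel_act M_ind Sinv Ssh ww vacE).
    - have [|j ij] := ord_succ (i := i); first by lia.
      by apply: (short_long_comm M_ind _ (mulr1 1) _ _ (Ssh i j ij) (Slo l ln)) => //;
        apply: ord_neq; lia.
    - have il : l = i.+1 :> nat by lia.
      have iNl : i != l by apply: ord_neq; lia.
      have E m : S i (S l (S i (S l m))) = S l (S i (S l (S i m))).
        apply: (short_long_braid4 xc M_ind iNl (Ssh i l il) (Slo l ln)) => // g.
        (* The relation has eight letters on one side. Applying it to the vector l i l i [vac g],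
           which is again some [vac], and cancelling squares leaves the balanced form i l i l = l i
           l i. *)
        have := S_word Sv [:: l; i; l; i] g; rewrite /= => e.
        by rewrite [RHS]e -[RHS]vacE -e !Sinv.
      by move=> m; rewrite E !Sinv.
  have lNi i l : l.+1 = n -> i.+1 <> n -> i != l.
    by move=> ln i1; apply/eqP => il; apply: i1; rewrite il.
  have act2 := @free_act2 K _ M (hop x c S) m.
  case: pq => [l ln|i l ln i1|l ln|i l ln i1].
  - have [[_ sc] _] := Slo l ln.
    exact: (hact_eq2N (g := inr l) (h := inl (inr l)) (g' := inl (inr l)) (h' := inr l) (sc m)).
  - have [_ sf] := Slo l ln; have [_ sc] := sf i (lNi i l ln i1).
    exact: (hact_eq2 (g := inr l) (h := inl (inr i)) (g' := inl (inr i)) (h' := inr l) (sc m)).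
  - have [[sx _] _] := Slo l ln.
    rewrite linearD linearN linearZ /=.
    rewrite [X in X + _](act2 (inr l) (inl (inl l))).
    rewrite [X in _ + X = _](act2 (inl (inl l)) (inr l)) free_act1 /= sx.
    by rewrite addrAC addNr add0r /k scaleNr.
  - have [_ sf] := Slo l ln; have [sx _] := sf i (lNi i l ln i1).
    exact: (hact_eq2 (g := inr l) (h := inl (inl i)) (g' := inl (inl i)) (h' := inr l) (sx m)).
move=> F Fx Fc Fv i m.
have Fs w : F (S i (vac w)) = lmulop (hs u W special i) (F (vac w)).
  by rewrite Sv !Fv hweylM hweylE big_seq1.
pose x' := fun k => lmulop (hx u W special k); pose c' := fun k => lmulop (hc u W special k).
have [[j ij]|iE] := last_or i.
  exact: (@short_refl_intertwine K n _ M _ x c vac x' c' M_ind F Fx Fc u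
    _ _ _ _ _ (mulr1 1) (Ssh i j ij) (hs_short_refl _ _ _ ij) Fs).
exact: (@long_refl_intertwine K n _ M _ x c vac x' c' M_ind F Fx Fc
  _ _ _ _ (Slo i iE) (hsB_long_refl _ _ iE) Fs).
Qed.

End TypeB.
End Types.

(** * Bases and tensor products *)

Lemma linear_pack (K : comNzRingType) (U V : lmodType K) (f : U -> V) :
  linear f -> exists F : {linear U -> V}, F =1 f.
Proof.
by move=> fl; exists (HB.pack_for {linear U -> V} f (GRing.isLinear.Build _ _ _ _ f fl)).
Qed.

(** The index set G is left general: it is the Weyl group for the main argument and a single point
    for the spanning of C_n. *)
Lemma malg_model (K : comNzRingType) (n : nat) (G : choiceType) :
  let T := ('X_{1..n} * {ffun 'I_n -> bool} * G)%type in
  let b a e w : {malg K[T]} := << (a, e, w) >> in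
  let vac w := b mone [ffun=> false] w in
  exists x c : 'I_n -> {linear {malg K[T]} -> {malg K[T]}},
  [/\ cliffpoly x c, pbw_induction x c vac, pbw_extension x c vac
    & forall (a : 'X_{1..n}) (e : {ffun 'I_n -> bool}) w,
        opword x a (index_enum _) (opword c (fun i => e i) (index_enum _) (vac w)) = b a e w].
Proof.
move=> T b vac0.
have b_ext (N : lmodType K) (f : 'X_{1..n} -> {ffun 'I_n -> bool} -> G -> N) :
    exists F : {linear {malg K[T]} -> N}, forall a e w, F (b a e w) = f a e w.
  have [F FE] := linear_pack (linext_is_linear (fun t : T => f t.1.1 t.1.2 t.2)).
  by exists F => a e w; rewrite FE linextU.
have b_uniq (N : lmodType K) (F H : {malg K[T]} -> N) : linear F -> linear H ->
    (forall a e w, F (b a e w) = H (b a e w)) -> F =1 H.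
  by move=> Fl Hl FH; apply: eq_linear_malg => // -[[a e] w]; apply: FH.
have [x xE] := choice (fun j => b_ext _ (fun a e w => b (mmul (ucm j) a) e w)).
have [c cE] := choice (fun j => b_ext _ (fun a e w => csign K a e j *: b a (cflip e j) w)).
exists x, c; split.
- exact: (cliffpoly_model b_uniq xE cE).
- exact: (pbwmod_ind b_uniq xE cE).
- exact: (pbwmod_lift b_ext b_uniq xE cE).
- exact: (opword_vac xE cE).
Qed.

Lemma linear_span_ind (K : comNzRingType) (T : choiceType) (V : lmodType K)
    (F : {linear {malg K[T]} -> V}) (P : V -> Prop) :
  P 0 -> (forall z p q, P p -> P q -> P (z *: p + q)) ->
  (forall t, P (F << t >>)) -> forall m, P (F m).
Proof.
move=> P0 PD PU; apply: (malg_ind (P := fun m => P (F m))) => //.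
  by rewrite linear0.
by move=> z p q Pp Pq; rewrite linearP; apply: PD.
Qed.

Section CliffordSpanning.
Variables (K : comNzRingType) (n : nat).

Definition cliff_monomial (e : {ffun 'I_n -> bool}) : clifford K n :=
  \prod_(i < n) pgen _ i ^+ e i.

(** That the c^e span C_n is read off from the model with one-point G. Let the x_j act by 0 and the
    c_j by left multiplication on C_n; the resulting F from the model to C_n commutes with C_n and
    sends the vacuum to 1, hence is onto, and it maps each basis vector to some c^e or to 0. *)
Lemma clifford_ind (P : clifford K n -> Prop) :
  P 0 -> (forall z p q, P p -> P q -> P (z *: p + q)) ->
  (forall e, P (cliff_monomial e)) -> forall a, P a.
Proof.
move=> P0 PD Pe a.
have [x [c [xc _ M_lift bE]]] := malg_model K n unit.
have [_ _ _ cc cA] := xc.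
pose rel := clifford_rel (fgen K : 'I_n -> freealg K 'I_n).
have gg i : pgen rel i * pgen rel i = 1.
  by rewrite -apiM; apply/algquot_rel/clifford_sq.
have gA i j : i != j -> pgen rel i * pgen rel j = - (pgen rel j * pgen rel i).
  by move=> ij; rewrite -!apiM -linearN; apply/algquot_rel/clifford_anti.
have zl : linear (fun _ : clifford K n => 0 : clifford K n).
  by move=> z p q; rewrite scaler0 addr0.
have [Z ZE] := linear_pack zl.
have xc' : cliffpoly (fun _ => Z) (fun i => lmulop (pgen rel i)).
  split=> [j k|j|j k jk|j|j k jk] m; rewrite /= ?ZE ?lmulopE ?mulr0 ?oppr0 //.
  - by rewrite mulrA gg mul1r.
  - by rewrite !mulrA gA // mulNr.
have [F [Fv Fx Fc]] := M_lift (clifford K n) _ _ (fun=> 1) xc'.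
have act_rel p q : rel p q -> forall m, free_act c m p = free_act c m q.
  case=> [i|i j ij] m.
    exact: (etrans (free_act2 c m i i) (etrans (cc i m) (esym (free_act1 c m)))).
  exact: (etrans (free_act2 c m i j) (etrans (cA i j ij m) (esym (free_act2N c m j i)))).
have <- : F (pres_act (rel := rel) c (<< (mone, [ffun=> false], tt) >>) a) = a.
  by rewrite (pres_act_intertwine act_rel) // Fv mulr1.
apply: linear_span_ind => // -[[d e] []]; rewrite -bE.
rewrite (@opword_morph K n _ (clifford K n) F x (fun=> Z) _ _ _ Fx).
rewrite (@opword_morph K n _ (clifford K n) F c (fun i => lmulop (pgen rel i)) _ _ _ Fc).
rewrite Fv opword_lmulop mulr1.
(* The word x^d leaves c^e alone if d = 0 and kills it otherwise. *)
have [->|->] // : opword (fun _ => Z) d (index_enum _) (cliff_monomial e) = cliff_monomial e \/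
    opword (fun _ => Z) d (index_enum _) (cliff_monomial e) = 0.
  elim: (index_enum _) => /= [|i r]; first by left.
  by case: (d i) => [|k] // _; right; rewrite /= ZE.
Qed.

End CliffordSpanning.

Section TensorSpanning.
Variables (K : comNzRingType) (U V : lmodType K).

Lemma tensor_ind (P : tensor U V -> Prop) :
  P 0 -> (forall z p q, P p -> P q -> P (z *: p + q)) ->
  (forall a b, P (tens a b)) -> forall t, P t.
Proof.
move=> P0 PD PU; elim/lquotP=> p; apply: linear_span_ind => // -[a b].
exact: PU.
Qed.

Lemma tens0r (a : U) : tens a (0 : V) = 0.
Proof. by rewrite -[0 in LHS](scale0r (0 : V)) tens_Zr scale0r. Qed.

Lemma tens0l (b : V) : tens (0 : U) b = 0.
Proof. by rewrite -[0 in LHS](scale0r (0 : U)) tens_Zl scale0r. Qed.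

End TensorSpanning.

(** * From the bijection M -> H to the two forms of the theorem *)

Section Conclusion.
Variables (K : numClosedFieldType) (n : nat) (u : K).
Variables (W : seq 'I_n -> seq 'I_n -> Prop).
Variable special : freealg K (hgen n) -> freealg K (hgen n) -> Prop.
Local Notation H := (hcalg u W special).
Local Notation T := ('X_{1..n} * {ffun 'I_n -> bool} * invgroup W)%type.
Variable F : {linear {malg K[T]} -> H}.
Hypothesis FE : forall a e w, F << (a, e, w) >> =
  hmon u W special a * hcliff u W special e * hweyl u special w.
Hypothesis F_bij : bijective F.

Lemma bijection_pbw_basis : pbw_basis u W special.
Proof.
pose f (t : T) := let: (a, e, w) := t in
  hmon u W special a * hcliff u W special e * hweyl u special w.
have fF p : linext f p = F p.
  apply: eq_linear_malg p => [z p q|z p q|[[a e] w]]; rewrite ?linearP //.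
  by rewrite linextU FE.
split=> [p|h].
  have -> : linext f p = F p := fF p.
  by rewrite -(linear0 F); apply: (bij_inj F_bij).
have [g _ gK] := F_bij.
by exists (g h); apply: etrans (fF _) (gK h).
Qed.

Lemma cliff_to_hc_monomial e :
  cliff_to_hc u W special (cliff_monomial K e) = hcliff u W special e.
Proof.
have c1 : cliff_to_hc u W special 1 = 1 := pres_lift1 (@cliff_to_hc_rel K n u W special).
rewrite /cliff_monomial (big_morph _ (@cliff_to_hcM K n u W special) c1).
apply: eq_bigr => i _; case: (e i); last exact: c1.
by rewrite !expr1; apply: cliff_to_hc_gen.
Qed.

(** The multiplication map f satisfies f psi = F. As F is bijective, surjectivity of [psi] suffices
    for f to be bijective. *)
Let psi : {linear {malg K[T]} -> tensor (tensor {mpoly K[n]} (clifford K n)) {malg K[invgroup W]}} :=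
  linext (fun t : T => tens (tens (<< t.1.1 >> : {mpoly K[n]}) (cliff_monomial K t.1.2))
                            (<< t.2 >> : {malg K[invgroup W]})).

Let psiE a e w : psi << (a, e, w) >> =
  tens (tens (<< a >> : {mpoly K[n]}) (cliff_monomial K e)) << w >>.
Proof. exact: linextU. Qed.

Lemma psi_surj t : exists m, psi m = t.
Proof.
pose P t := exists m, psi m = t.
have P0 : P 0 by exists 0; rewrite linear0.
have PD z p q : P p -> P q -> P (z *: p + q).
  by move=> [m <-] [m' <-]; exists (z *: m + m'); rewrite linearP.
move: t; apply: (tensor_ind (P := P)) => // a g.
move: g; apply: (malg_ind (P := fun g => P (tens a g))) => [|z p q Pp Pq|w].
- by rewrite tens0r.
- by rewrite tens_Dr tens_Zr; apply: PD.
move: a; apply: (tensor_ind (P := fun a => P (tens a _))) => [|z p q Pp Pq|p a].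
- by rewrite tens0l.
- by rewrite tens_Dl tens_Zl; apply: PD.
move: a; apply: (clifford_ind (P := fun a => P (tens (tens p a) _))) => [|z a a' Pa Pa'|e].
- by rewrite tens0r tens0l.
- by rewrite tens_Dr tens_Zr tens_Dl tens_Zl; apply: PD.
move: p; apply: (malg_ind (P := fun p => P (tens (tens p _) _))) => [|z p q Pp Pq|a].
- by rewrite tens0l tens0l.
- by rewrite tens_Dl tens_Zl tens_Dl tens_Zl; apply: PD.
by exists << (a, e, w) >>; apply: psiE.
Qed.

Lemma bijection_mult_iso : mult_iso u W special.
Proof.
pose P := poly_to_hc u W special; pose C := cliff_to_hc u W special.
pose Y := weyl_to_hc u special (W := W).
have Pl : linear P := linext_is_linear _.
have Yl : linear Y := linext_is_linear _.
have Cl : linear C := pres_lift_linear (@cliff_to_hc_rel K n u W special).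
have ml z (a a' h : H) : (z *: a + a') * h = z *: (a * h) + a' * h.
  by rewrite mulrDl -algquot_scalerAl.
have mr z (h a a' : H) : h * (z *: a + a') = z *: (h * a) + h * a'.
  by rewrite mulrDr -algquot_scalerAr.
pose f1 := tensor_lift (fun p a => P p * C a).
have f1E p a : f1 (tens p a) = P p * C a.
  by apply: tensor_liftE => [q z r r'|q z r r']; rewrite /= (Pl, Cl) (ml, mr).
have f1l : linear f1.
  by apply: tensor_lift_linear => [q z r r'|q z r r']; rewrite /= (Pl, Cl) (ml, mr).
pose f2 := tensor_lift (fun t g => f1 t * Y g).
have f2E t g : f2 (tens t g) = f1 t * Y g.
  by apply: tensor_liftE => [q z r r'|q z r r']; rewrite /= (f1l, Yl) (ml, mr).
have f2l : linear f2.
  by apply: tensor_lift_linear => [q z r r'|q z r r']; rewrite /= (f1l, Yl) (ml, mr).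
have [f fE] := linear_pack f2l.
have fpsi m : f (psi m) = F m.
  move: m; apply: eq_linear_malg => [z p q|z p q|[[a e] w]]; rewrite ?linearP //.
  rewrite psiE fE f2E f1E FE.
  by congr (_ * _ * _); [apply: linextU|apply: cliff_to_hc_monomial|apply: linextU].
exists f; split=> [p a g|]; first by rewrite fE f2E f1E.
have [g Fg gF] := F_bij.
exists (psi \o g) => [t|h] /=; last by rewrite fpsi gF.
by have [m <-] := psi_surj t; rewrite fpsi Fg.
Qed.

End Conclusion.

Local Close Scope ring_scope.

Theorem theorem3p11 (R : realType) (n : nat) (u v : R[i]) :
  (4 <= n ->
     mult_iso u (weylD_rel n) (hcD_special n u) /\
     pbw_basis u (weylD_rel n) (hcD_special n u)) /\
  (2 <= n ->
     mult_iso u (weylB_rel n) (hcB_special n v) /\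
     pbw_basis u (weylB_rel n) (hcB_special n v)).
Proof.
split=> ln.
  have [x [c [xc M_ind M_lift bE]]] := malg_model (R[i]) n (invgroup (weylD_rel n)).
  have [F [FE Fb]] := typeD_bijection u ln xc M_ind M_lift bE.
  by split; [apply: bijection_mult_iso FE Fb|apply: bijection_pbw_basis FE Fb].
have [x [c [xc M_ind M_lift bE]]] := malg_model (R[i]) n (invgroup (weylB_rel n)).
have [F [FE Fb]] := typeB_bijection u v xc M_ind M_lift bE.
by split; [apply: bijection_mult_iso FE Fb|apply: bijection_pbw_basis FE Fb].
Qed.
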